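(* There is an algorithm that, given a digraph $D$ on $n$ vertices and a positive integer $k$, decides whether $\ell(D)\geq k$ (the problem $k$-Leaf Out-Tree) in time $2^{O(k\log k)}\cdot n^{O(1)}$.
   Context: An out-tree of a digraph $D$ is a subgraph of $D$ that is a tree (ignoring arc directions) in which exactly one vertex, the root, has in-degree $0$ and every other vertex has in-degree $1$. A leaf of an out-tree is a vertex of out-degree $0$ in it. $\ell(D)$ denotes the maximum number of leaves over all out-trees of $D$. *)

(* Defs.v *)
From mathcomp Require Import all_boot.
Set Implicit Arguments. Unset Strict Implicit. Unset Printing Implicit Defensive.

(* A digraph on n vertices is a relation [a : rel 'I_n] (arc u -> v iff
   a u v); the theorem assumes it loopless (irreflexive).              *)

Section OutTree.
Variable n : nat.
Variable a : rel 'I_n.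

Definition und (A : {set 'I_n * 'I_n}) : rel 'I_n :=
  fun x y => ((x, y) \in A) || ((y, x) \in A).

Definition indeg (A : {set 'I_n * 'I_n}) (v : 'I_n) : nat :=
  #|[set u | (u, v) \in A]|.
Definition outdeg (A : {set 'I_n * 'I_n}) (v : 'I_n) : nat :=
  #|[set w | (v, w) \in A]|.

Definition subgraphb (S : {set 'I_n}) (A : {set 'I_n * 'I_n}) : bool :=
  [forall e in A, [&& a e.1 e.2, e.1 \in S & e.2 \in S]].

(* the underlying undirected (multi)graph of (S, A) is a tree:
   connected, and acyclic (every edge is a bridge) *)
Definition treeb (S : {set 'I_n}) (A : {set 'I_n * 'I_n}) : bool :=
  [&& S != set0,
      [forall x in S, forall y in S, connect (und A) x y] &
      [forall e in A, ~~ connect (und (A :\ e)) e.1 e.2]].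

Definition outtreeb (S : {set 'I_n}) (A : {set 'I_n * 'I_n}) : bool :=
  [&& subgraphb S A, treeb S A,
      #|[set v in S | indeg A v == 0]| == 1 &
      [forall v in S, (indeg A v == 0) || (indeg A v == 1)]].

Definition leaves (S : {set 'I_n}) (A : {set 'I_n * 'I_n}) : {set 'I_n} :=
  [set v in S | outdeg A v == 0].

(* l(D): maximum number of leaves of an out-tree of D (0 if none) *)
Definition ell : nat :=
  \max_(S : {set 'I_n}) \max_(A : {set 'I_n * 'I_n} | outtreeb S A)
     #|leaves S A|.

End OutTree.

(* Model of computation: a unit-cost RAM with addition and (truncated) *)
(* subtraction, constants, indirect addressing and conditional jumps.  *)

Inductive instr : Type :=
| IConst of nat & nat
| IAdd of nat & nat & nat
| ISub of nat & nat & nat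
| ILoad of nat & nat
| IStore of nat & nat
| IJz of nat & nat
| IJmp of nat
| IHalt.

Definition program := seq instr.

Record state := State { pc : nat; mem : nat -> nat }.

Definition upd (m : nat -> nat) (r v : nat) : nat -> nat :=
  fun x => if x == r then v else m x.

(* a state is halted when the current instruction is IHalt or the
   program counter is out of range *)
Definition halted (P : program) (s : state) : bool :=
  if nth IHalt P (pc s) is IHalt then true else false.

Definition step (P : program) (s : state) : state :=
  let m := mem s in let p := pc s in
  match nth IHalt P p with
  | IConst r c => State p.+1 (upd m r c)
  | IAdd r x y => State p.+1 (upd m r (m x + m y))
  | ISub r x y => State p.+1 (upd m r (m x - m y))
  | ILoad r x => State p.+1 (upd m r (m (m x)))
  | IStore x r => State p.+1 (upd m (m x) (m r))
  | IJz r l => if m r == 0 then State l m else State p.+1 m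
  | IJmp l => State l m
  | IHalt => s
  end.

Fixpoint run (P : program) (t : nat) (s : state) : option (nat -> nat) :=
  if halted P s then Some (mem s)
  else match t with
       | 0 => None
       | t'.+1 => run P t' (step P s)
       end.

Definition init (w : seq nat) : state := State 0 (fun i => nth 0 w i).

Definition encode (n : nat) (a : rel 'I_n) (k : nat) : seq nat :=
  [:: n; k] ++ [seq nat_of_bool (a i j) | i <- enum 'I_n, j <- enum 'I_n].

(* Main.v *)
Require Import Defs.
From mathcomp Require Import all_boot.
From mathcomp Require Import zify.
Set Implicit Arguments. Unset Strict Implicit. Unset Printing Implicit Defensive.

(* The algorithm follows Kneis, Langer and Rossmanith.  Up to the choice of a
   root [r], a set [I] of inner vertices each reachable from [r] inside [I]
   extends to an out-tree whose leaves are the out-neighbours of [I] outside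
   [I] (its frontier), so one looks for such an [I] with a frontier of size
   [k].  Grow [I] from the empty set: pick an undecided frontier vertex [u] and
   branch on whether it remains a leaf (0) or becomes inner (1).  If making [u]
   inner reaches only one new vertex [v], then [v] may be forced to be inner as
   well, since otherwise [u] could have stayed a leaf in place of [v]; and a
   vertex reaching nothing new may stay a leaf.  Hence every
   branching increases 2 * #(decided leaves) + #(undecided frontier vertices),
   and [2 k] bits of branching suffice.  The RAM tries all roots and all
   [g < 4 ^ k], reading the bits of [g] from the top by doubling and comparing
   with [4 ^ k]. *)

(** * Branching search *)

(** The two directions are of different kinds. Soundness holds for every guess: the marked vertices
    always span an out-tree, and the frontier counter never exceeds its number of leaves.
    Completeness asks for one good guess, assembled along a run that declares a vertex a leaf
    whenever a solution survives this; a vertex becomes inner only if it must, which rules out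
    expansions that reach nothing new. The decided leaves belong to the frontier, so the measure is
    at most twice the size of the frontier, hence below [2 * k] while the frontier is smaller than
    [k]: the bits cannot run out before success. A chain of forced expansions gains nothing until
    its last member reaches two new vertices; the whole chain is charged to the single bit that
    started it. On the machine the obstacle is that the input fills the low addresses, leaving no
    working registers, and that there is no multiplication. Diagonal entries of the matrix are the
    only input cells that may be overwritten, and they are a constant stride [n.+1] apart, which
    makes them reachable by additions. *)

(* A vertex [v] has mark 0 if untouched, 1 if it is an undecided frontier vertex
   and 2 if it is inner or a decided leaf; [fr] is the size of the frontier;
   [fw] is [v.+1] if [v] is forced to be inner and 0 otherwise; [cn] counts the
   vertices reached by the last expansion. *)
Record conf := Conf { mk : nat -> nat; fr : nat; fw : nat; cn : nat }.

Section Search.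
Variables (n : nat) (adj : nat -> nat -> bool).

(* One plus an undecided vertex, or 0. *)
Definition blue (mk : nat -> nat) : nat :=
  foldl (fun z v => if mk v == 1 then v.+1 else z) 0 (iota 0 n).

(** The first new vertex is recorded in [fw] and a second one erases it, so after a full scan [fw]
    names a vertex exactly when a single new one was found. *)
Definition grow (u : nat) (s : conf) (v : nat) : conf :=
  if (mk s v == 0) && adj u v
  then Conf (upd (mk s) v 1) (fr s).+1 (if cn s == 0 then v.+1 else 0) (cn s).+1
  else s.

Definition expand (u : nat) (s : conf) : conf :=
  foldl (grow u) (Conf (upd (mk s) u 2) (fr s - 1) 0 0) (iota 0 n).

Definition advance (b : bool) (s : conf) : conf :=
  let z := if fw s == 0 then blue (mk s) else fw s in
  if z == 0 then s
  else if b then expand z.-1 s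
  else Conf (upd (mk s) z.-1 2) (fr s) (fw s) (cn s).

Variables (k T : nat).

Definition shift (h : nat) : nat := if T <= h + h then h + h - T else h + h.

Definition step1 (p : conf * nat) : conf * nat :=
  if fw p.1 == 0 then (advance (T <= p.2 + p.2) p.1, shift p.2)
  else (advance true p.1, p.2).

Definition start (r : nat) : conf := Conf (fun v => v == r) 1 0 0.

(** Each effective step settles one more vertex, so [n] steps exhaust the search and [n.+1]
    configurations are inspected. *)
Definition accepts (r g : nat) : bool :=
  has (fun i => k <= fr (iter i step1 (start r, g)).1) (iota 0 n.+1).

Definition solve : bool :=
  has (fun r => has (accepts r) (iota 0 T)) (iota 0 n).

End Search.

Lemma iota0S i : iota 0 i.+1 = rcons (iota 0 i) i.
Proof. by rewrite -addn1 iotaD cats1. Qed.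

Lemma foldl_iotaS (S : Type) (f : S -> nat -> S) s i :
  foldl f s (iota 0 i.+1) = f (foldl f s (iota 0 i)) i.
Proof. by rewrite iota0S foldl_rcons. Qed.

Lemma has_iotaS (f : nat -> bool) i : has f (iota 0 i.+1) = f i || has f (iota 0 i).
Proof. by rewrite iota0S has_rcons. Qed.

Lemma grow_marked adj u v w s : mk s w != 0 -> mk (grow adj u s v) w = mk s w.
Proof.
rewrite /grow; case: ifP => //= /andP[/eqP mv _] mw; rewrite /upd.
by have [E|//] := eqVneq w v; rewrite E mv in mw.
Qed.

Lemma foldl_grow_marked adj u w s l :
  mk s w != 0 -> mk (foldl (grow adj u) s l) w = mk s w.
Proof. by elim: l s => //= v l IH s mw; rewrite IH ?grow_marked. Qed.

Lemma blue_le n m : blue n m <= n.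
Proof.
elim: n => // n IH; rewrite /blue foldl_iotaS; case: ifP => // _; exact: leqW.
Qed.

Lemma foldl_grow_fw_le adj u s n :
  fw s = 0 -> fw (foldl (grow adj u) s (iota 0 n)) <= n.
Proof.
move=> s0; elim: n => [|n IH]; first by rewrite /= s0.
rewrite foldl_iotaS {1}/grow; case: ifP => /= _; last by apply: leqW.
by case: (cn _ == 0).
Qed.

(** Guards a store: the mark of a forced vertex must lie within the mark array. *)
Lemma step1_fw_le n adj T p : fw p.1 <= n -> fw (step1 n adj T p).1 <= n.
Proof.
have Hn b s : fw s <= n -> fw (advance n adj b s) <= n.
  move=> Hs; rewrite /advance; case: ifP => // _; case: b => //.
  exact: foldl_grow_fw_le.
by move=> Hp; rewrite /step1; case: ifP => _; apply: Hn.
Qed.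

Lemma iter_step1_fw_le n adj T i p : fw p.1 <= n -> fw (iter i (step1 n adj T) p).1 <= n.
Proof. by move=> Hp; elim: i => //= i; apply: step1_fw_le. Qed.

(** * Structured programs for the RAM *)

Inductive cmd : Type :=
| Skip
| Op of instr
| Seq of cmd & cmd
| If of nat & cmd & cmd
| While of nat & cmd.

Fixpoint len (c : cmd) : nat :=
  match c with
  | Skip => 0
  | Op _ => 1
  | Seq c1 c2 => len c1 + len c2
  | If _ c1 c2 => (len c1 + len c2).+2
  | While _ c1 => (len c1).+2
  end.

(** Jump targets are absolute, hence the load address [p]. *)
Fixpoint comp (p : nat) (c : cmd) : program :=
  match c with
  | Skip => [::]
  | Op i => [:: i]
  | Seq c1 c2 => comp p c1 ++ comp (p + len c1) c2
  | If r c1 c2 =>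
      IJz r (p.+2 + len c1) :: comp p.+1 c1
        ++ IJmp (p.+2 + len c1 + len c2) :: comp (p.+2 + len c1) c2
  | While r c1 => IJz r (p.+2 + len c1) :: comp p.+1 c1 ++ [:: IJmp p]
  end.

Lemma size_comp c p : size (comp p c) = len c.
Proof.
elim: c p => //= [c1 IH1 c2 IH2|r c1 IH1 c2 IH2|r c1 IH1] p;
  by rewrite !size_cat /= ?IH1 ?IH2 ?addnS ?addn0.
Qed.

Definition code_at (P : program) (p : nat) (c : program) : Prop :=
  forall i, i < size c -> nth IHalt P (p + i) = nth IHalt c i.

Lemma code_at_cat P p c1 c2 :
  code_at P p (c1 ++ c2) -> code_at P p c1 /\ code_at P (p + size c1) c2.
Proof.
move=> H; split=> i Hi.
  by rewrite H ?nth_cat ?Hi // size_cat ltn_addr.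
by rewrite -addnA H ?size_cat ?ltn_add2l // nth_cat ltnNge leq_addr /= addKn.
Qed.

Lemma code_at_cons P p i c :
  code_at P p (i :: c) -> nth IHalt P p = i /\ code_at P p.+1 c.
Proof.
move=> H; split; first by have := H 0 isT; rewrite addn0.
by move=> j Hj; rewrite addSnnS (H j.+1).
Qed.

Notation memory := (nat -> nat).

(* Total correctness within [T] steps, for the compiled code at any position of
   any program. *)
Definition wp (c : cmd) (T : nat) (Q : memory -> Prop) (m : memory) : Prop :=
  forall P p, code_at P p (comp p c) ->
  exists t m', [/\ t <= T, Q m' &
    forall t', run P (t + t') (State p m) = run P t' (State (p + len c) m')].

Lemma wp_weaken c T T' (Q Q' : memory -> Prop) m :
  T <= T' -> (forall m', Q m' -> Q' m') -> wp c T Q m -> wp c T' Q' m.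
Proof.
move=> HT HQ H P p /H [t [m' [Ht Hm' E]]]; exists t, m'.
by split=> //; [exact: leq_trans HT | exact: HQ].
Qed.

Lemma wp_skip (Q : memory -> Prop) m : Q m -> wp Skip 0 Q m.
Proof. by move=> HQ P p _; exists 0, m; split=> //= t'; rewrite addn0. Qed.

Definition op_effect (i : instr) (m : memory) : option memory :=
  match i with
  | IConst r c => Some (upd m r c)
  | IAdd r x y => Some (upd m r (m x + m y))
  | ISub r x y => Some (upd m r (m x - m y))
  | ILoad r x => Some (upd m r (m (m x)))
  | IStore x r => Some (upd m (m x) (m r))
  | _ => None
  end.

Lemma wp_op i (Q : memory -> Prop) m m' :
  op_effect i m = Some m' -> Q m' -> wp (Op i) 1 Q m.
Proof.
move=> Hi HQ P p /code_at_cons [Hp _]; exists 1, m'; split=> // t'.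
by rewrite addn1 add1n /= /halted /step /= Hp; case: i Hi {Hp} => //= *; congruence.
Qed.

Lemma wp_seq c1 c2 T1 T2 Q m :
  wp c1 T1 (wp c2 T2 Q) m -> wp (Seq c1 c2) (T1 + T2) Q m.
Proof.
move=> H P p /code_at_cat [/H [t1 [m1 [Ht1 H1 E1]]]].
rewrite size_comp => /H1 [t2 [m2 [Ht2 HQ E2]]].
exists (t1 + t2), m2; split=> [||t']; [exact: leq_add|by []|].
by rewrite -addnA E1 E2 addnA.
Qed.

Lemma wp_if r c1 c2 T1 T2 Q m :
  (m r != 0 -> wp c1 T1 Q m) -> (m r = 0 -> wp c2 T2 Q m) ->
  wp (If r c1 c2) (T1 + T2 + 2) Q m.
Proof.
move=> H1 H2 P p /= /code_at_cons [Hp] /code_at_cat [Hc1].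
rewrite size_comp => /code_at_cons [Hj Hc2].
have [r0|r0] := eqVneq (m r) 0.
  have [|t [m' [Ht HQ E]]] := H2 r0 P (p.+2 + len c1); first by rewrite addSn addSn in
    Hc2 *.
  exists t.+1, m'; split=> // [|t']; first by lia.
  rewrite addSn /= /halted /step /= Hp r0 /= E; congr run; congr State; lia.
have [t [m' [Ht HQ E]]] := H1 r0 P p.+1 Hc1.
exists t.+2, m'; split=> // [|t']; first by lia.
have ->: t.+2 + t' = (t + t'.+1).+1 by lia.
rewrite /= /halted /step /= Hp (negbTE r0) E /=.
rewrite /halted /step /= Hj; congr run; congr State; lia.
Qed.

(** The index of the invariant is the number of passes left; it serves as termination measure and
    determines when the tested register vanishes. Each pass adds the test and the backward jump to
    the body. *)
Lemma wp_while r c T (Inv : nat -> memory -> Prop) j m :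
  (forall j m, Inv j m -> (m r == 0) = (j == 0)) ->
  (forall j m, Inv j.+1 m -> wp c T (Inv j) m) ->
  Inv j m -> wp (While r c) (j * (T + 2) + 1) (Inv 0) m.
Proof.
move=> Hr Hc Hm P p Hcode; move: (Hcode) => /= /code_at_cons [Hp] /code_at_cat [Hc1].
rewrite size_comp => /code_at_cons [Hj _].
elim: j m Hm => [|j IH] m Hm; have := Hr _ _ Hm.
  move=> /eqP r0; exists 1, m; split=> // t'.
  rewrite add1n /= /halted /step /= Hp r0 /=; congr run; congr State; lia.
move=> r0; have [t [m1 [Ht H1 E1]]] := Hc _ _ Hm _ _ Hc1.
have [t2 [m2 [Ht2 H2 E2]]] := IH _ H1.
exists (t + t2).+2, m2; split=> // [|t']; first by lia.
have ->: (t + t2).+2 + t' = (t + (t2 + t').+1).+1 by lia.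
rewrite /= /halted /step /= Hp r0 E1 /=.
by rewrite /halted /step /= Hj E2.
Qed.

Definition blk : seq cmd -> cmd := foldr Seq Skip.
Arguments blk : simpl never.

Lemma wp_blk_cons c cs T1 T2 Q m :
  wp c T1 (wp (blk cs) T2 Q) m -> wp (blk (c :: cs)) (T1 + T2) Q m.
Proof. exact: wp_seq. Qed.

(* Addresses below 25 serve as registers. *)
Notation W := 25 (only parsing).
Notation rN := 0 (only parsing).
Notation rK := 1 (only parsing).
Notation rBase := 2 (only parsing).
Notation rStride := 3 (only parsing).
Notation rOne := 4 (only parsing).
Notation rW := 5 (only parsing).
Notation rMarks := 6 (only parsing).
Notation rT := 7 (only parsing).
Notation rAns := 8 (only parsing).
Notation rR := 9 (only parsing).
Notation rG := 10 (only parsing).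
Notation rV := 11 (only parsing).
Notation rCount := 12 (only parsing).
Notation rIt := 13 (only parsing).
Notation rFront := 14 (only parsing).
Notation rForced := 15 (only parsing).
Notation rH := 16 (only parsing).
Notation rZ := 17 (only parsing).
Notation rBit := 18 (only parsing).
Notation rU := 19 (only parsing).
Notation rRow := 20 (only parsing).
Notation rX := 21 (only parsing).
Notation rY := 22 (only parsing).
Notation rNew := 23 (only parsing).
Notation rJ := 24 (only parsing).

(** All loops, nested ones included, share [rCount]: it is recomputed from bound and index after
    every pass, so the body may overwrite it. *)
Definition For (ri rn : nat) (body : cmd) : cmd :=
  blk [:: Op (IConst ri 0); Op (ISub rCount rn ri);
          While rCount (blk [:: body; Op (IAdd ri ri rOne);
                                Op (ISub rCount rn ri)])].

(** A partial description of the registers: one that is missing may hold anything. With concrete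
    keys, [get] and [put] evaluate, so that symbolic execution and its side conditions reduce to
    computation. *)
Definition regs := seq (nat * nat).
Definition keys (l : regs) : seq nat := map fst l.
Fixpoint get (l : regs) (r : nat) : nat :=
  if l is (x, v) :: l' then if x == r then v else get l' r else 0.
Fixpoint put (l : regs) (r v : nat) : regs :=
  if l is (x, w) :: l' then
    if x == r then (r, v) :: l' else (x, w) :: put l' r v
  else [:: (r, v)].

Lemma keys_put l r v x : (x \in keys (put l r v)) = (x == r) || (x \in keys l).
Proof.
elim: l => //= -[y w] l IH /=; case: eqVneq => [->|_]; rewrite !inE ?orbA ?orbb //.
by rewrite IH orbCA orbA.
Qed.

Lemma get_put l r v x : get (put l r v) x = if x == r then v else get l x.
Proof.
elim: l => [|[y w] l IH] /=; first by rewrite eq_sym.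
have [->|yr] /= := eqVneq y r; first by rewrite [r == x]eq_sym; case: eqP.
rewrite IH; have [<-|//] := eqVneq y x.
by rewrite (negbTE yr).
Qed.

Definition sub_regs (l l' : regs) : Prop :=
  forall r, r \in keys l' -> r \in keys l /\ get l r = get l' r.

Lemma sub_regs_all l l' :
  all (fun r => (r \in keys l) && (get l r == get l' r)) (keys l') -> sub_regs l l'.
Proof. by move=> /allP H r /H /andP[? /eqP]. Qed.

(** * Memory layout and Hoare triples *)

Section Triples.
Variables (n : nat) (adj : nat -> nat -> bool).

(* The input cells at addresses 3, ..., 24 are displaced to the addresses
   [base + r * (n + 1)], which hold (unused) diagonal entries of the adjacency
   matrix or lie beyond the input. *)
Definition base : nat := 2 + W * n.+1.
Definition marks : nat := 2 + (n + 2 * W) * n.+1.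
Definition loc (q : nat) : nat := if q < W then base + q * n.+1 else q.

Definition stores_adj (m : memory) : Prop :=
  forall u v, u < n -> v < n -> u != v -> m (loc (2 + u * n + v)) = adj u v.

Definition represents (l : regs) (mk m : memory) : Prop :=
  [/\ forall r, r \in keys l -> m r = get l r, stores_adj m
    & forall v, v < n -> m (marks + v) = mk v].

Lemma loc_ge q : W <= loc q.
Proof. by rewrite /loc /base; case: (ltnP q W) => // _; nia. Qed.

Lemma loc_lt u v : u < n -> v < n -> loc (2 + u * n + v) < marks.
Proof. by rewrite /loc /base /marks; case: (ltnP (2 + u * n + v) W); nia. Qed.

Lemma marks_ge v : W <= marks + v.
Proof. by rewrite /marks; nia. Qed.

Lemma represents_put l mk m r x :
  r < W -> represents l mk m -> represents (put l r x) mk (upd m r x).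
Proof.
move=> rW [Hl Ha Hm]; split.
- move=> y; rewrite keys_put get_put /upd; case: eqP => //= _; exact: Hl.
- move=> u v Hu Hv uv; rewrite /upd; have := loc_ge (2 + u * n + v).
  by case: eqP => [->|_ _]; [lia | exact: Ha].
- move=> v Hv; rewrite /upd; have := marks_ge v.
  by case: eqP => [->|_ _]; [lia | exact: Hm].
Qed.

Lemma represents_sub l l' mk m : sub_regs l l' -> represents l mk m -> represents l' mk m.
Proof. by move=> S [Hl Ha Hm]; split=> // r /S[/Hl -> ->]. Qed.

Definition triple (l : regs) (mk : memory) (c : cmd) (T : nat) (l' : regs)
  (mk' : memory) :=
  all (fun r => r < W) (keys l) -> forall m, represents l mk m -> wp c T
    (represents l' mk') m.

Lemma triple_weaken l mk c T T' l' mk' :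
  T <= T' -> triple l mk c T l' mk' -> triple l mk c T' l' mk'.
Proof. by move=> HT H Hl m /(H Hl); apply: wp_weaken. Qed.

Lemma represents_ext l mk mk' m :
  (forall v, v < n -> mk v = mk' v) -> represents l mk m -> represents l mk' m.
Proof. by move=> E [Hl Ha Hm]; split=> // v Hv; rewrite Hm // E. Qed.

Lemma triple_end l l' mk mk' : (forall v, v < n -> mk v = mk' v) -> sub_regs l l' ->
  triple l mk (blk [::]) 0 l' mk'.
Proof. by move=> E S _ m H; apply: wp_skip; apply: represents_ext E _; apply:
  represents_sub H. Qed.

Lemma triple_conseq l0 l1 mk0 mk1 l mk c T l' mk' :
  all (fun r => r < W) (keys l0) ->
  (forall v, v < n -> mk v = mk0 v) -> sub_regs l l0 ->
  (forall v, v < n -> mk1 v = mk' v) -> sub_regs l1 l' ->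
  triple l0 mk0 c T l1 mk1 -> triple l mk c T l' mk'.
Proof.
move=> Hl0 E0 S0 E1 S1 H _ m /(represents_ext E0)/(represents_sub S0) /(H Hl0).
by apply: wp_weaken => // m' /(represents_ext E1)/(represents_sub S1).
Qed.

Lemma keys_ltW_put l r v : r < W -> all (fun r => r < W) (keys l) ->
  all (fun r => r < W) (keys (put l r v)).
Proof. by move=> rW /allP H; apply/allP=> x; rewrite keys_put => /orP[/eqP->|/H]. Qed.

Lemma triple_set i r x l mk cs T l' mk' :
  r < W -> (forall m, represents l mk m -> op_effect i m = Some (upd m r x)) ->
  triple (put l r x) mk (blk cs) T l' mk' ->
  triple l mk (blk (Op i :: cs)) T.+1 l' mk'.
Proof.
move=> rW Hi H Hl m Hm; rewrite -add1n; apply: wp_blk_cons.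
apply: wp_op; first exact: Hi.
by apply: H; [exact: keys_ltW_put | exact: represents_put].
Qed.

Lemma triple_const r c l mk cs T l' mk' :
  r < W -> triple (put l r c) mk (blk cs) T l' mk' ->
  triple l mk (blk (Op (IConst r c) :: cs)) T.+1 l' mk'.
Proof. by move=> rW; apply: triple_set. Qed.

Lemma triple_add r x y l mk cs T l' mk' :
  [&& r < W, x \in keys l & y \in keys l] ->
  triple (put l r (get l x + get l y)) mk (blk cs) T l' mk' ->
  triple l mk (blk (Op (IAdd r x y) :: cs)) T.+1 l' mk'.
Proof.
by move=> /and3P[rW Hx Hy]; apply: triple_set => // m [Hl _ _] /=; rewrite !Hl.
Qed.

Lemma triple_sub r x y l mk cs T l' mk' :
  [&& r < W, x \in keys l & y \in keys l] ->
  triple (put l r (get l x - get l y)) mk (blk cs) T l' mk' ->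
  triple l mk (blk (Op (ISub r x y) :: cs)) T.+1 l' mk'.
Proof.
by move=> /and3P[rW Hx Hy]; apply: triple_set => // m [Hl _ _] /=; rewrite !Hl.
Qed.

Lemma triple_load_adj r x u v l mk cs T l' mk' :
  [&& r < W & x \in keys l] -> [&& u < n, v < n & u != v] ->
  get l x = loc (2 + u * n + v) ->
  triple (put l r (adj u v)) mk (blk cs) T l' mk' ->
  triple l mk (blk (Op (ILoad r x) :: cs)) T.+1 l' mk'.
Proof.
move=> /andP[rW Hx] /and3P[Hu Hv uv] E; apply: triple_set => // m [Hl Ha _] /=.
by rewrite (Hl x) // E Ha.
Qed.

Lemma triple_load_mark r x v l mk cs T l' mk' :
  [&& r < W & x \in keys l] -> v < n -> get l x = marks + v ->
  triple (put l r (mk v)) mk (blk cs) T l' mk' ->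
  triple l mk (blk (Op (ILoad r x) :: cs)) T.+1 l' mk'.
Proof.
move=> /andP[rW Hx] Hv E; apply: triple_set => // m [Hl _ Hm] /=.
by rewrite (Hl x) // E Hm.
Qed.

Lemma triple_store x r v l mk cs T l' mk' :
  [&& r \in keys l & x \in keys l] -> v < n -> get l x = marks + v ->
  triple l (upd mk v (get l r)) (blk cs) T l' mk' ->
  triple l mk (blk (Op (IStore x r) :: cs)) T.+1 l' mk'.
Proof.
move=> /andP[Hr Hx] Hv E H Hl m Hm; rewrite -add1n; apply: wp_blk_cons.
apply: wp_op; first by [].
apply: H => //; case: Hm => Hlm Ha Hm; rewrite (Hlm _ Hx) E (Hlm _ Hr); split.
- move=> y Hy; rewrite /upd; have := allP Hl _ Hy; have := marks_ge v.
  by case: eqP => [->|_ _ _]; [lia | exact: Hlm].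
- move=> u w Hu Hw uw; rewrite /upd; have := loc_lt Hu Hw.
  by case: eqP => [->|_ _]; [lia | exact: Ha].
- by move=> w Hw; rewrite /upd eqn_add2l; case: eqP => // _; exact: Hm.
Qed.

Lemma triple_if l1 mk1 T1 T2 r c1 c2 l mk cs T l' mk' :
  r \in keys l -> all (fun r => r < W) (keys l1) ->
  (get l r <> 0 -> triple l mk c1 T1 l1 mk1) ->
  (get l r = 0 -> triple l mk c2 T2 l1 mk1) ->
  triple l1 mk1 (blk cs) T l' mk' ->
  triple l mk (blk (If r c1 c2 :: cs)) (T1 + T2 + 2 + T) l' mk'.
Proof.
move=> Hr Hl1 H1 H2 H Hl m Hm; apply: wp_blk_cons; have Er: m r = get l r by case: Hm
  => ->.
apply: wp_if => [/eqP|] r0; rewrite Er in r0.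
  by apply: wp_weaken (H1 r0 Hl m Hm) => // m1; apply: H.
by apply: wp_weaken (H2 r0 Hl m Hm) => // m1; apply: H.
Qed.

Lemma triple_seq l1 mk1 T1 c l mk cs T l' mk' :
  all (fun r => r < W) (keys l1) ->
  triple l mk c T1 l1 mk1 -> triple l1 mk1 (blk cs) T l' mk' ->
  triple l mk (blk (c :: cs)) (T1 + T) l' mk'.
Proof.
move=> Hl1 H1 H Hl m Hm; apply: wp_blk_cons.
by apply: wp_weaken (H1 Hl m Hm) => // m1; apply: H.
Qed.

(** [L i] and [MK i] describe the state before pass [i]; the index is tracked separately and
    [rCount] is left free for the body. A pass costs four instructions besides the body (test,
    increment, recount, jump); initialisation and the last test account for the 3. *)
Lemma triple_for (L : nat -> regs) (MK : nat -> memory) N T0 ri rn body l mk cs T l' mk' :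
  [&& ri < W, ri != rCount & all (fun r => r < W) (keys l)] ->
  (forall i, [&& all (fun r => r < W) (keys (L i)), rn \in keys (L i),
    rOne \in keys (L i), ri \notin keys (L i) & rCount \notin keys (L i)]) ->
  (forall i, get (L i) rn = N /\ get (L i) rOne = 1) ->
  (forall v, v < n -> mk v = MK 0 v) -> sub_regs l (L 0) ->
  (forall i, i < N ->
     triple ((ri, i) :: L i) (MK i) body T0 ((ri, i) :: L i.+1) (MK i.+1)) ->
  triple (L N) (MK N) (blk cs) T l' mk' ->
  triple l mk (blk (For ri rn body :: cs)) (N * (T0 + 4) + 3 + T) l' mk'.
Proof.
move=> /and3P[riW riC _] HK HN E0 S0 Hb H Hl m Hm; apply: wp_blk_cons.
pose Inv j m := j <= N /\ represents ((rCount, j) :: (ri, N - j) :: L (N - j))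
  (MK (N - j)) m.
have Hstep i m' : i <= N -> represents ((ri, i) :: L i) (MK i) m' ->
    represents ((rCount, N - i) :: (ri, i) :: L i) (MK i) (upd m' rCount (N - i)).
  move=> _ /(@represents_put _ _ _ rCount (N - i)) -/(_ isT); apply: represents_sub => r.
  by rewrite keys_put get_put /= !inE [rCount == r]eq_sym; case: eqVneq.
have Hset i v m' : represents (L i) (MK i) m' -> represents ((ri, v) :: L i) (MK i)
  (upd m' ri v).
  move=> /(@represents_put _ _ _ ri v) -/(_ riW); apply: represents_sub => r /=.
  by rewrite inE keys_put get_put eq_sym.
have Hrn i m' : represents (L i) (MK i) m' -> m' rn = N /\ m' rOne = 1.
  have [_ H1 H2 _ _] := and5P (HK i).
  by move=> [Hl' _ _]; rewrite !Hl' //; apply: HN.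
have Htail i v m' : represents ((ri, v) :: L i) (MK i) m' -> represents (L i) (MK i) m'.
  apply: represents_sub => r Hr /=; rewrite inE Hr orbT; split=> //.
  by case: eqVneq Hr => // <-; case/and5P: (HK i) => _ _ _ /negbTE ->.
have Eri i v m' : represents ((ri, v) :: L i) (MK i) m' -> m' ri = v.
  by move=> [H1 _ _]; rewrite H1 /= ?eqxx // inE eqxx.
have -> : N * (T0 + 4) + 3 = 1 + (1 + ((N * ((T0 + (1 + (1 + 0))) + 2) + 1) + 0)) by lia.
apply: wp_blk_cons; apply: wp_op; first by [].
have Hm0 := Hset 0 0 _ (represents_ext E0 (represents_sub S0 Hm)).
apply: wp_blk_cons; apply: wp_op; first by [].
have HInv : Inv N (upd (upd m ri 0) rCount (upd m ri 0 rn - upd m ri 0 ri)).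
  split=> //; rewrite subnn (Eri _ _ _ Hm0) (Hrn _ _ (Htail _ _ _ Hm0)).1 subn0.
  by have := Hstep 0 _ (leq0n _) Hm0; rewrite subn0.
apply: wp_blk_cons; apply: wp_weaken (wp_while _ _ HInv) => //.
- move=> m' [_]; rewrite subn0 => HmN; apply: wp_skip.
  apply: H => //; first by case/and5P: (HK N).
  apply: (Htail N N); apply: represents_sub HmN => r /=; rewrite !inE => Hr.
  rewrite Hr orbT; split=> //; rewrite eq_sym; case: (eqVneq r rCount) Hr => [->|//].
  by rewrite eq_sym (negbTE riC) /=; case/and5P: (HK N) => _ _ _ _ /negbTE ->.
- by move=> j m' [_ [-> //]].
- move=> j m' [Hj HM].
  apply: wp_blk_cons; set i := N - j.+1 in HM *.
  have Ei : i.+1 = N - j by rewrite /i; lia.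
  have Hi : i < N by rewrite /i; lia.
  apply: (wp_weaken (T := T0)) (Hb i Hi _ _ _) => //.
  + move=> m1 Hm1; apply: wp_blk_cons; apply: wp_op; first by [].
    rewrite (Eri _ _ _ Hm1) (Hrn _ _ (Htail _ _ _ Hm1)).2 addn1.
    have Hm2 := Hset _ i.+1 _ (Htail _ _ _ Hm1).
    apply: wp_blk_cons; apply: wp_op; first by [].
    rewrite (Eri _ _ _ Hm2) (Hrn _ _ (Htail _ _ _ Hm2)).1.
    apply: wp_skip; split; first by lia.
    have := Hstep _ _ Hi Hm2; rewrite Ei.
    by have -> : N - (N - j) = j by lia.
  + by rewrite /= riW; case/and5P: (HK i).
  + apply: represents_sub HM => r /=; rewrite !inE => Hr.
    rewrite Hr orbT; split=> //; rewrite eq_sym; case: (eqVneq r rCount) Hr => [->|//].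
    by rewrite eq_sym (negbTE riC) /=; case/and5P: (HK i) => _ _ _ _ /negbTE ->.
Qed.

End Triples.

(** * The search on the RAM *)

(** Computes [loc] of the address in [rX], then loads. The multiplication loop is entered only for
    addresses below [W], so it makes at most 24 passes and a read takes constant time. *)
Definition read_code : seq cmd :=
  [:: Op (ISub rY rW rX);
      If rY (blk [:: Op (IConst rY 0); Op (IAdd rY rY rBase);
                     For rJ rX (blk [:: Op (IAdd rY rY rStride)]);
                     Op (IConst rX 0); Op (IAdd rX rX rY)])
            (blk [::]);
      Op (ILoad rX rX)].

Definition grow_code : cmd :=
  blk [:: Op (IAdd rX rMarks rV); Op (ILoad rX rX);
    If rX (blk [::])
      (blk ([:: Op (IAdd rX rRow rV)] ++ read_code ++
        [:: If rX
          (blk [:: Op (IAdd rX rMarks rV); Op (IStore rX rOne);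
                   Op (IAdd rFront rFront rOne);
                   If rNew (blk [:: Op (IConst rForced 0)])
                           (blk [:: Op (IAdd rForced rV rOne)]);
                   Op (IAdd rNew rNew rOne)])
          (blk [::])]))].

(** The row address is summed up once, so that each entry of the row then costs one addition. The
    mark 2 of the expanded vertex is stored beforehand by [step_code], as both outcomes of a bit
    need it. *)
Definition expand_code : cmd :=
  blk [:: Op (ISub rFront rFront rOne); Op (IConst rForced 0);
          Op (IConst rNew 0); Op (IConst rRow 2);
          For rJ rU (blk [:: Op (IAdd rRow rRow rN)]);
          For rV rN grow_code].

(** Under truncated subtraction [h + h + 1 - T] is nonzero exactly when [T <= h + h]; likewise a
    mark is 1 when it is nonzero and its predecessor is zero. *)
Definition choose_code : cmd :=
  blk [:: Op (IConst rBit 1); Op (IConst rZ 0); Op (IAdd rZ rZ rForced);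
    If rForced (blk [::])
      (blk [:: For rV rN
                 (blk [:: Op (IAdd rX rMarks rV); Op (ILoad rX rX);
                    If rX (blk [:: Op (ISub rX rX rOne);
                                   If rX (blk [::]) (blk [:: Op (IAdd rZ rV rOne)])])
                          (blk [::])]);
               Op (IAdd rH rH rH); Op (IAdd rX rH rOne); Op (ISub rX rX rT);
               If rX (blk [:: Op (ISub rH rH rT)])
                     (blk [:: Op (IConst rBit 0)])])].

Definition step_code : cmd :=
  blk [:: Op (ISub rX rK rFront); If rX (blk [::]) (blk [:: Op (IConst rAns 1)]);
    choose_code;
    If rZ (blk [:: Op (ISub rU rZ rOne); Op (IConst rX 2); Op (IAdd rY rMarks rU);
                   Op (IStore rY rX); If rBit expand_code (blk [::])])
          (blk [::])].

(** [rStride] holds [n.+1], which is also the number of configurations to inspect. [rAns] is never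
    cleared here, so it accumulates the verdicts of all runs. *)
Definition sim_code : cmd :=
  blk [:: Op (IConst rX 0);
    For rV rN (blk [:: Op (IAdd rY rMarks rV); Op (IStore rY rX)]);
    Op (IAdd rY rMarks rR); Op (IStore rY rOne);
    Op (IConst rFront 1); Op (IConst rForced 0); Op (IConst rNew 0);
    Op (IConst rH 0); Op (IAdd rH rH rG);
    For rIt rStride step_code].

Definition solve_code : cmd := For rR rN (blk [:: For rG rT sim_code]).

Ltac hadd := apply: triple_add; [done|]; rewrite /=.
Ltac hsub := apply: triple_sub; [done|]; rewrite /=.
Ltac hconst := apply: triple_const; [done|]; rewrite /=.
Ltac hend := apply: triple_end;
  [try done | apply: sub_regs_all; rewrite /= ?eqxx ?andbT //].
Ltac hfor L MK :=
  apply: (triple_for (L := L) (MK := MK));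
  [done | done | by move=> ?; split; rewrite /=; reflexivity | try done
  | try by apply: sub_regs_all; rewrite /= ?eqxx | | ]; rewrite /=.
(** Leaves the time open: the rules synthesise it, and the last goal compares it with the stated
    bound. *)
Ltac weak := eapply triple_weaken; last first.

(** * Verification of the search code *)

Section Code.
Variables (n : nat) (adj : nat -> nat -> bool) (k T : nat).
Notation triple := (triple n adj).

Section Step.
Variables (r g it : nat).

Definition env : regs :=
  [:: (rN, n); (rK, k); (rBase, base n); (rStride, n.+1); (rOne, 1); (rW, W);
      (rMarks, marks n); (rT, T); (rR, r); (rG, g); (rIt, it)].

Definition conf_regs (s : conf) : regs :=
  [:: (rFront, fr s); (rForced, fw s); (rNew, cn s)].

Definition grow_regs (ans h u : nat) (s : conf) : regs :=
  [:: (rU, u); (rRow, 2 + u * n); (rAns, ans); (rH, h)] ++ conf_regs s ++ env.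

Lemma grow_triple ans h u v s : u < n -> v < n -> mk s u != 0 ->
  triple ((rV, v) :: grow_regs ans h u s) (mk s) grow_code 400
     ((rV, v) :: grow_regs ans h u (grow adj u s v)) (mk (grow adj u s v)).
Proof.
move=> Hu Hv mu.
weak.
  rewrite /grow_code; hadd.
  apply: (@triple_load_mark _ _ _ _ v) => //=.
  apply: (@triple_if _ _ ((rV, v) :: grow_regs ans h u (grow adj u s v))
    (mk (grow adj u s v))) => //=.
  - by move=> mv; rewrite /grow; case: eqP => //= _; hend.
  (* [u] is marked and [v] is not, so a diagonal cell is never read. *)
  - move=> mv; have uv : u != v by apply: contraNneq mu => ->; rewrite mv.
    hadd; hsub.
    apply: (@triple_if _ _
      ((rX, loc n (2 + u * n + v)) :: (rV, v) :: grow_regs ans h u s) (mk s)) => //=.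
    + move=> lW; eapply (triple_weaken (T' := 200)); last first.
      hconst; hadd.
      hfor (fun i : nat => [:: (rX, 2 + u * n + v); (rY, base n + i * n.+1); (rV, v)]
        ++ grow_regs ans h u s) (fun _ : nat => mk s).
      * by apply: sub_regs_all; rewrite /= ?eqxx ?andbT //; apply/eqP; lia.
      * move=> i _; hadd; hend; apply/eqP; lia.
      * hconst; hadd; hend; rewrite /loc; case: ltnP => //; lia.
      * lia.
    + move=> lW; hend; rewrite /loc; case: ltnP => //; lia.
    + apply: (@triple_load_adj _ _ _ _ u v) => //=; first by rewrite Hu Hv.
      apply: (@triple_if _ _ ((rV, v) :: grow_regs ans h u (grow adj u s v))
        (mk (grow adj u s v))) => //=.
      * rewrite /grow mv eqxx; case: (adj u v) => // _ /=.
        hadd; apply: (@triple_store _ _ _ _ v) => //=; hadd.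
        apply: (@triple_if _ _
          [:: (rV, v), (rForced, if cn s == 0 then v.+1 else 0), (rFront, (fr s).+1) &
            grow_regs ans h u s] (upd (mk s) v 1)) => //=.
        -- by move=> /eqP/negbTE E0; hconst; hend; rewrite E0 ?addn1 ?eqxx.
        -- by move=> E0; hadd; hend; rewrite E0 ?addn1 ?eqxx.
        -- by hadd; hend; rewrite ?addn1 ?eqxx.
      * by rewrite /grow mv eqxx; case: (adj u v) => //= _; hend.
      * hend.
  - hend.
- lia.
Qed.

Definition step_regs (ans h : nat) (s : conf) : regs :=
  [:: (rAns, ans); (rH, h)] ++ conf_regs s ++ env.

Lemma expand_triple ans h u s : u < n ->
  triple ((rU, u) :: step_regs ans h s) (upd (mk s) u 2) expand_code (410 * n + 20)
     (step_regs ans h (expand n adj u s)) (mk (expand n adj u s)).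
Proof.
move=> Hu; weak.
  rewrite /expand_code; hsub; hconst; hconst; hconst.
  pose s0 := Conf (upd (mk s) u 2) (fr s - 1) 0 0.
  hfor (fun i : nat => [:: (rU, u); (rRow, 2 + i * n)] ++ step_regs ans h s0)
                      (fun _ : nat => upd (mk s) u 2).
  - by move=> i _; hadd; hend; apply/eqP; lia.
  - pose S i := foldl (grow adj u) s0 (iota 0 i).
    hfor (fun i => grow_regs ans h u (S i)) (fun i => mk (S i)).
    + move=> i Hi; rewrite /S foldl_iotaS; apply: grow_triple => //.
      by rewrite foldl_grow_marked /= /upd eqxx.
    + by hend.
- lia.
Qed.

Lemma choose_triple ans h s : let z := if fw s == 0 then blue n (mk s) else fw s in
  let b := (fw s != 0) || (T <= h + h) in
  let h' := if fw s == 0 then shift T h else h in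
  triple (step_regs ans h s) (mk s) choose_code (30 * n + 30)
     ([:: (rZ, z); (rBit, nat_of_bool b)] ++ step_regs ans h' s) (mk s).
Proof.
move=> z b h'; weak.
  rewrite /choose_code; hconst; hconst; hadd.
  apply: (@triple_if _ _ ([:: (rZ, z); (rBit, nat_of_bool b)] ++ step_regs ans h' s)
    (mk s)) => //=.
  - by move=> /eqP/negbTE f0; hend; rewrite /z /b /h' f0 /= ?eqxx.
  - move=> f0; rewrite /z /b /h' f0 /=.
    pose Z i := foldl (fun z v => if mk s v == 1 then v.+1 else z) 0 (iota 0 i).
    hfor (fun i : nat => [:: (rZ, Z i); (rBit, 1)] ++ step_regs ans h s)
      (fun _ : nat => mk s).
    + by apply: sub_regs_all; rewrite /= f0 ?eqxx.
    + move=> i Hi; hadd; apply: (@triple_load_mark _ _ _ _ i) => //=.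
      apply: (@triple_if _ _
        ((rV, i) :: [:: (rZ, Z i.+1); (rBit, 1)] ++ step_regs ans h s) (mk s)) => //=.
      * move=> mi; hsub.
        apply: (@triple_if _ _
          ((rV, i) :: [:: (rZ, Z i.+1); (rBit, 1)] ++ step_regs ans h s) (mk s)) => //=.
        -- move=> mi'; hend; rewrite /Z foldl_iotaS; have -> : (mk s i == 1) = false by
             lia. by rewrite eqxx.
        -- move=> mi'; hadd; hend; rewrite /Z foldl_iotaS addn1; have -> : mk s i == 1
             by lia. by rewrite eqxx.
        -- by hend.
      * by move=> mi; hend; rewrite /Z foldl_iotaS mi /= eqxx.
      * by hend.
    + hadd; hadd; hsub.
      apply: (@triple_if _ _
        ([:: (rZ, Z n); (rBit, nat_of_bool (T <= h + h))] ++ step_regs ans (shift T h)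
          s) (mk s)) => //=.
      * move=> HT; hsub; hend; rewrite /shift; case: leqP => //; lia.
      * move=> HT; hconst; hend; rewrite /shift; case: leqP => //; lia.
      * by hend; rewrite f0.
  - by hend.
- lia.
Qed.

Lemma step_triple ans h s : fw s <= n ->
  let p := step1 n adj T (s, h) in
  triple (step_regs ans h s) (mk s) step_code (450 * n + 150)
     (step_regs (if k <= fr s then 1 else ans) p.2 p.1) (mk p.1).
Proof.
move=> Hfw p; set ans' := (if _ then 1 else ans).
pose z := if fw s == 0 then blue n (mk s) else fw s.
pose b := (fw s != 0) || (T <= h + h).
pose h' := if fw s == 0 then shift T h else h.
have -> : p = (if z == 0 then s else if b then expand n adj z.-1 s
    else Conf (upd (mk s) z.-1 2) (fr s) (fw s) (cn s), h').
  by rewrite /p /step1 /advance /z /b /h' /=; case: (fw s == 0).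
have Hz : z <= n by rewrite /z; case: ifP => // _; apply: blue_le.
weak.
- rewrite /step_code; hsub.
  apply: (@triple_if _ _ (step_regs ans' h s) (mk s)) => //=.
  + by move=> Hk; hend; rewrite /ans'; have -> : (k <= fr s) = false by lia.
  + by move=> Hk; hconst; hend; rewrite /ans'; have -> : k <= fr s by lia.
  + apply: (triple_seq (l1 := [:: (rZ, z); (rBit, nat_of_bool b)] ++
      step_regs ans' h' s) (mk1 := mk s)) => //.
      exact: choose_triple.
    set s' := (if z == 0 then _ else _).
    apply: (@triple_if _ _ (step_regs ans' h' s') (mk s')) => //=.
    * move=> z0; hsub; hconst; hadd; rewrite subn1.
      have zn : z.-1 < n by lia.
      have z0' : (z == 0) = false by apply/eqP.
      apply: (@triple_store _ _ _ _ z.-1) => //=.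
      apply: (@triple_if _ _ (step_regs ans' h' s') (mk s')) => //=.
      -- move=> Hb; have {}Hb : b = true by case: (b) Hb.
         refine (triple_conseq _ _ _ _ _ (@expand_triple ans' h' z.-1 s zn));
           [done | done | | |].
         ++ by apply: sub_regs_all; rewrite /= ?eqxx.
         ++ by move=> v _; rewrite /s' z0' Hb.
         ++ by rewrite /s' z0' Hb.
      -- move=> Hb; have {}Hb : b = false by case: (b) Hb.
         apply: triple_end.
         ++ by move=> v _; rewrite /s' z0' Hb.
         ++ by rewrite /s' z0' Hb; apply: sub_regs_all; rewrite /= ?eqxx.
      -- by hend.
    * move=> z0; apply: triple_end.
      -- by rewrite /s' z0.
      -- by rewrite /s' z0; apply: sub_regs_all; rewrite /= ?eqxx.
    * by hend.
- lia.
Qed.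
End Step.

Definition env0 (ans : nat) : regs :=
  [:: (rAns, ans); (rN, n); (rK, k); (rBase, base n); (rStride, n.+1);
      (rOne, 1); (rW, W); (rMarks, marks n); (rT, T)].

Definition final (r g : nat) : conf := (iter n.+1 (step1 n adj T) (start r, g)).1.

Lemma sim_triple ans r g mk0 : r < n ->
  triple ([:: (rR, r); (rG, g)] ++ env0 ans) mk0 sim_code
    (n.+1 * (450 * n + 154) + 6 * n + 50)
     ([:: (rR, r); (rG, g)] ++ env0 (if accepts n adj k T r g then 1 else ans))
     (mk (final r g)).
Proof.
move=> Hr; weak.
- rewrite /sim_code; hconst.
  hfor (fun _ : nat => [:: (rX, 0); (rR, r); (rG, g)] ++ env0 ans)
       (fun i v : nat => if v < i then 0 else mk0 v).
  + move=> i Hi; hadd; apply: (@triple_store _ _ _ _ i) => //=; hend.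
    move=> v Hv; rewrite /upd ltnS [v <= i]leq_eqVlt; by case: eqP.
  + hadd; apply: (@triple_store _ _ _ _ r) => //=.
    hconst; hconst; hconst; hconst; hadd.
    pose p i := iter i (step1 n adj T) (start r, g).
    (* Each pass tests the frontier before it steps, so passes 0 to [n] test exactly the
       configurations that [accepts] inspects. *)
    pose A i := if has (fun i => k <= fr (p i).1) (iota 0 i) then 1 else ans.
    hfor (fun i : nat => [:: (rAns, A i); (rH, (p i).2); (rR, r); (rG, g)] ++
                         conf_regs (p i).1 ++ behead (env0 0))
                           (fun i : nat => mk (p i).1).
    * by move=> v Hv; rewrite /upd Hv; case: eqP.
    * move=> i Hi; apply: (triple_conseq (l0 := step_regs r g i (A i) (p i).2 (p i).1)
        (mk0 := mk (p i).1) (l1 := step_regs r g i (A i.+1) (p i.+1).2 (p i.+1).1)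
        (mk1 := mk (p i.+1).1)); [done | done | | done | | ].
      -- by apply: sub_regs_all; rewrite /= ?eqxx.
      -- by apply: sub_regs_all; rewrite /= ?eqxx.
      -- have := @step_triple r g i (A i) (p i).2 (p i).1.
         rewrite -surjective_pairing -[step1 _ _ _ _]/(p i.+1) /=.
         rewrite /A has_iotaS; case: (k <= _) => /= H; apply: H;
         exact: iter_step1_fw_le.
    * by hend.
- lia.
Qed.

Lemma solve_triple mk0 : 0 < T -> exists mk1,
  triple (env0 0) mk0 (blk [:: solve_code])
    (n * (T * (n.+1 * (450 * n + 154) + 6 * n + 60) + 10) + 10)
     (env0 (solve n adj k T)) mk1.
Proof.
(* The marks left behind are those of the last run, with root [n.-1] and guess [T.-1]; for [n = 0]
   no run takes place. *)
move=> HT; exists (if n is n'.+1 then mk (final n' T.-1) else mk0); weak.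
- rewrite /solve_code.
  pose A i := nat_of_bool
    (has (fun r => has (accepts n adj k T r) (iota 0 T)) (iota 0 i)).
  hfor (fun i : nat => env0 (A i))
    (fun i : nat => if i is i'.+1 then mk (final i' T.-1) else mk0).
  + move=> r Hr.
    pose B i := if has (accepts n adj k T r) (iota 0 i) then 1 else A r.
    hfor (fun i : nat => (rR, r) :: env0 (B i))
         (fun i : nat => if i is i'.+1 then mk (final r i') else
            if r is r'.+1 then mk (final r' T.-1) else mk0).
    * move=> g Hg; set mk' := (match g with 0 => _ | _ => _ end).
      refine (triple_conseq _ _ _ _ _ (@sim_triple (B g) r g mk' Hr));
        [done | done | | done | ].
      -- by apply: sub_regs_all; rewrite /= ?eqxx.
      -- by rewrite /B has_iotaS; case: (accepts _ _ _ _ r g) => /=;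
         apply: sub_regs_all; rewrite /= ?eqxx.
    * apply: triple_end; first by case: T HT.
      rewrite /B /A has_iotaS; case: (has _ _) => /=;
      by apply: sub_regs_all; rewrite /= ?eqxx.
  + by hend.
- lia.
Qed.
End Code.

(** * Freeing the registers *)

(** Unrolled, because no register is free for a loop counter at this stage. *)
Definition scale_code (j : nat) : seq cmd := nseq j (Op (IAdd rBase rBase rN)).
Definition save_code (rs : seq nat) : seq cmd :=
  flatten [seq [:: Op (IAdd rBase rBase rStride); Op (IStore rBase r)] | r <- rs].

(** Cell 2 is the diagonal entry (0, 0), the only cell that can be used at once. The constants come
    from [base n + 3 * n.+1 = 30 + 28 * n], the new place of cell 3, and [base n = 27 + 25 * n].
    Once cell 3 is saved it holds the stride, and the other 21 cells follow at two instructions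
    each. *)
Definition boot_code : seq cmd :=
  [:: Op (IConst rBase 30)] ++ scale_code 28 ++
  [:: Op (IStore rBase 3); Op (IConst rStride 1); Op (IAdd rStride rStride rN)] ++
  save_code (iota 4 21) ++
  [:: Op (IConst rBase 27)] ++ scale_code 25.

Definition setup_code : seq cmd :=
  [:: Op (IConst rOne 1); Op (IConst rW W); Op (IConst rMarks 2);
      Op (IConst rX 50); Op (IAdd rX rX rN);
      For rJ rX (blk [:: Op (IAdd rMarks rMarks rStride)]);
      Op (IConst rT 1);
      For rJ rK (blk [:: Op (IAdd rT rT rT); Op (IAdd rT rT rT)]);
      Op (IConst rAns 0)].

Definition main_code : cmd :=
  blk (boot_code ++ setup_code ++
       [:: blk [:: solve_code]; Op (IConst 0 0); Op (IAdd 0 0 rAns)]).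

Lemma wp_scale j cs T Q m :
  (forall m', m' 2 = m 2 + j * m 0 -> (forall q, q != 2 -> m' q = m q) ->
     wp (blk cs) T Q m') ->
  wp (blk (scale_code j ++ cs)) (j + T) Q m.
Proof.
elim: j m => [|j IH] m H; first by apply: H; rewrite ?addn0.
have -> : j.+1 + T = 1 + (j + T) by lia.
rewrite /scale_code /=; apply: wp_blk_cons; apply: wp_op; first by [].
apply: IH => m' E2 Eq; apply: H => [|q q2].
  by rewrite E2 /upd /=; lia.
by rewrite Eq // /upd (negbTE q2).
Qed.

Section Boot.
Variables (n : nat) (w : nat -> nat).

(** The state once cells 3 to [j.-1] have been copied, with cell 2 pointing at the last copy. Cell 2
    has lost its input value. *)
Record saved (j : nat) (m : memory) : Prop := Saved {
  saved_n : m 0 = n;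
  saved_k : m 1 = w 1;
  saved_ptr : m 2 = base n + j.-1 * n.+1;
  saved_stride : m 3 = n.+1;
  saved_done : forall r, 3 <= r < j -> m (base n + r * n.+1) = w r;
  saved_todo : forall q, j <= q < W -> m q = w q;
  saved_high : forall q, W <= q -> (forall r, 3 <= r < W -> q != base n + r * n.+1) ->
    m q = w q }.

Lemma low_ne q r : q < W -> (q == base n + r * n.+1) = false.
Proof. by move=> qW; apply/eqP => E; move: qW; rewrite E /base; nia. Qed.

Lemma wp_save j i cs T Q m :
  3 < j -> j + i <= W -> saved j m ->
  (forall m', saved (j + i) m' -> wp (blk cs) T Q m') ->
  wp (blk (save_code (iota j i) ++ cs)) (2 * i + T) Q m.
Proof.
elim: i j m => [|i IH] j m Hj Hi S H; first by apply: H; rewrite addn0.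
have -> : 2 * i.+1 + T = 1 + (1 + (2 * i + T)) by lia.
rewrite /save_code /=; apply: wp_blk_cons; apply: wp_op; first by [].
apply: wp_blk_cons; apply: wp_op; first by [].
case: S => S0 S1 S2 S3 S4 S5 S6.
have Ep : upd m 2 (m 2 + m 3) 2 = base n + j * n.+1.
  by rewrite /upd /= S2 S3 -addnA -mulSnr prednK //; lia.
have Er : upd m 2 (m 2 + m 3) j = w j.
  by rewrite /upd; case: eqP => [|_]; [lia | apply: S5; lia].
rewrite Ep Er; set m1 := upd _ _ _.
have Elow q : q < W -> q != 2 -> m1 q = m q.
  by move=> qW q2; rewrite /m1 /upd (negbTE q2) low_ne.
apply: IH => [||| m']; [lia | lia | | by rewrite addSnnS; apply: H].
split => /=.
- by rewrite Elow.
- by rewrite Elow.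
- by rewrite -Ep /m1 {1}/upd low_ne.
- by rewrite Elow.
- move=> r Hr; rewrite /m1 {1}/upd eqn_add2l eqn_pmul2r // /upd.
  case: eqP => [-> //|rj]; rewrite eq_sym low_ne //.
  by apply: S4; lia.
- by move=> q Hq; rewrite Elow; [apply: S5; lia | lia | lia].
- move=> q Hq Hr; rewrite /m1 /upd (negbTE (Hr j _)); last by lia.
  by case: eqP => [|_]; [lia | apply: S6].
Qed.

Lemma wp_boot cs T Q m :
  m =1 w -> w 0 = n ->
  (forall m' m1, saved W m1 -> m' 2 = base n -> (forall q, q != 2 -> m' q = m1 q) ->
     wp (blk cs) T Q m') ->
  wp (blk (boot_code ++ cs)) (100 + T) Q m.
Proof.
move=> Em En H.
have -> : 100 + T = 1 + (28 + (1 + (1 + (1 + (2 * 21 + (1 + (25 + T))))))) by lia.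
rewrite /boot_code -!catA; apply: wp_blk_cons; apply: wp_op; first by [].
apply: wp_scale => m1 E2 E1; rewrite /upd /= Em En in E2.
apply: wp_blk_cons; apply: wp_op; first by [].
apply: wp_blk_cons; apply: wp_op; first by [].
apply: wp_blk_cons; apply: wp_op; first by [].
set m2 := upd _ _ _.
have Ep : m1 2 = base n + 3 * n.+1 by rewrite E2 /base; lia.
have Elow q : q < W -> q != 3 -> m2 q = m1 q.
  by move=> qW q3; rewrite /m2 /upd (negbTE q3) Ep low_ne.
have Em1 q : q != 2 -> m1 q = w q by move=> q2; rewrite E1 // /upd (negbTE q2).
apply: (@wp_save 4 21) => //.
- split => /=.
  + by rewrite Elow // Em1.
  + by rewrite Elow // Em1.
  + by rewrite Elow.
  + by rewrite /m2 /upd /=; case: eqP => [|_]; [lia | rewrite Em1 // En add1n].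
  + move=> r Hr; have -> : r = 3 by lia.
    by rewrite /m2 /upd Ep eqxx !(eq_sym _ 3) (@low_ne 3) // eqxx Em1.
  + by move=> q Hq; rewrite Elow ?Em1 //; lia.
  + move=> q Hq Hr; rewrite /m2 /upd Ep (negbTE (Hr 3 _)) //.
    have -> : (q == 3) = false by lia.
    by rewrite Em1 //; lia.
- move=> m3 S; apply: wp_blk_cons; apply: wp_op; first by [].
  apply: wp_scale => m4 E4 E4'.
  apply: (H _ _ S) => [|q q2]; first by rewrite E4 /upd /= (saved_n S) /base; lia.
  by rewrite E4' // /upd (negbTE q2).
Qed.
End Boot.

Lemma represents_boot n (w : nat -> nat) (adj : nat -> nat -> bool) m' m1 :
  (forall u v, u < n -> v < n -> w (2 + u * n + v) = adj u v) ->
  saved n w W m1 -> m' 2 = base n -> (forall q, q != 2 -> m' q = m1 q) ->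
  represents n adj [:: (0, n); (1, w 1); (2, base n); (3, n.+1)]
    (fun v => m' (marks n + v)) m'.
Proof.
move=> Ew S E2 Em; split=> [r|u v Hu Hv uv|//].
  by rewrite !inE => /or4P[]/eqP-> //=; rewrite Em //; case: S.
have Hq : 2 < 2 + u * n + v by move: uv; rewrite -addnA -addn1 leq_add2l; nia.
rewrite Em; last by have := loc_ge n (2 + u * n + v); lia.
rewrite /loc -Ew //; case: ltnP => qW; first by apply: (saved_done S); lia.
apply: (saved_high S) => // r Hr; apply/eqP; rewrite /base => E.
(* A clash with a copy would put the entry at position [q * n + q], and uniqueness of division by
   [n] would make it diagonal. *)
have [q [Eq ru]] : exists q, u * n + v = q * n + q /\ W <= q by exists (W + r); nia.
have qn : q < n by nia.
by case: (ltngtP u q) => uq; [nia | nia | move: uv; rewrite uq in Eq *; lia].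
Qed.

Lemma setup_triple n adj k mk0 : exists mk1,
  triple n adj [:: (0, n); (1, k); (2, base n); (3, n.+1)] mk0
    (blk (setup_code ++ [:: blk [:: solve_code]; Op (IConst 0 0); Op (IAdd 0 0 rAns)])) 
    (5 * (n + 50) + 6 * k + 30 +
     (n * (4 ^ k * (n.+1 * (450 * n + 154) + 6 * n + 60) + 10) + 10))
    [:: (0, nat_of_bool (solve n adj k (4 ^ k)))] mk1.
Proof.
have [|mk1 H] := @solve_triple n adj k (4 ^ k) mk0; first by rewrite expn_gt0.
exists mk1; weak.
- rewrite /setup_code /=; hconst; hconst; hconst; hconst; hadd.
  hfor (fun i : nat => [:: (0, n); (1, k); (2, base n); (3, n.+1); (rOne, 1); (rW, W);
          (rX, 50 + n); (rMarks, 2 + i * n.+1)]) (fun _ : nat => mk0).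
  + by move=> i Hi; hadd; hend; apply/eqP; lia.
  + hconst.
    hfor (fun i : nat => [:: (0, n); (1, k); (2, base n); (3, n.+1); (rOne, 1); (rW, W);
          (rMarks, marks n); (rT, 4 ^ i)]) (fun _ : nat => mk0).
    * apply: sub_regs_all; rewrite /= ?eqxx ?andbT //=; apply/eqP; rewrite /marks; lia.
    * move=> i Hi; hadd; hadd; hend; apply/eqP; rewrite expnS; lia.
    * hconst; apply: (triple_seq (l1 := env0 n k (4 ^ k) (solve n adj k (4 ^ k)))
        (mk1 := mk1)).
      -- by [].
      -- refine (triple_conseq _ _ _ _ _ H); [done | done | | done | done].
         by apply: sub_regs_all; rewrite /= ?eqxx.
      -- by rewrite /=; hconst; hadd; hend.
- lia.
Qed.

(** * Running time and output *)

Definition main_time (n k : nat) : nat :=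
  100 + (5 * (n + 50) + 6 * k + 30 +
     (n * (4 ^ k * (n.+1 * (450 * n + 154) + 6 * n + 60) + 10) + 10)).

Lemma main_time_le n k L : 0 < k -> 0 < L ->
  main_time n k <= 2 ^ (14 * k * L) * n.+1 ^ 14.
Proof.
move=> k0 L0.
(* The factor 4096 = 2 ^ 12 absorbs all coefficients of a cubic in [n.+1]; since [k] and [L] are
   positive, [2 * k + 12 <= 14 * k * L], whence the constant 14. *)
have H1 : 4 ^ k * 4096 <= 2 ^ (14 * k * L).
  have -> : 4 ^ k * 4096 = 2 ^ (2 * k + 12) by rewrite expnD expnM.
  rewrite leq_exp2l //; nia.
have H2 : n.+1 ^ 3 <= n.+1 ^ 14 by rewrite leq_pexp2l.
apply: leq_trans (leq_mul H1 H2).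
have Hk : k <= 4 ^ k by apply: ltnW; apply: ltn_expl.
rewrite /main_time; move: (4 ^ k) Hk => K Hk.
have -> : n.+1 ^ 3 = n * n * n + 3 * (n * n) + 3 * n + 1 by rewrite !expnS expn0; lia.
nia.
Qed.

Lemma main_run n (adj : nat -> nat -> bool) k (w : seq nat) t :
  nth 0 w 0 = n -> nth 0 w 1 = k ->
  (forall u v, u < n -> v < n -> nth 0 w (2 + u * n + v) = adj u v) ->
  main_time n k <= t ->
  exists2 m, run (comp 0 main_code) t (init w) = Some m
    & m 0 = solve n adj k (4 ^ k).
Proof.
move=> En Ek Ew Ht.
have Hat : code_at (comp 0 main_code) 0 (comp 0 main_code) by [].
have : wp main_code (main_time n k) (fun m => m 0 = solve n adj k (4 ^ k)) (nth 0 w).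
  apply: (@wp_boot n (nth 0 w)) => // m' m1 S E2 Em.
  have [mk1 H] := @setup_triple n adj k (fun v => m' (marks n + v)).
  have HM := represents_boot Ew S E2 Em; rewrite Ek in HM.
  by apply: wp_weaken (H isT _ HM) => // m2 [-> //].
move=> /(_ _ _ Hat) [s [m [Hs Hm E]]]; exists m => //.
rewrite /init -(subnKC (leq_trans Hs Ht)) E add0n.
(* Control runs off the end of the program, where [nth] returns its default [IHalt]. *)
have HP : halted (comp 0 main_code) (State (len main_code) m).
  by rewrite /halted nth_default // size_comp.
by case: (t - s) => [|j]; rewrite /run HP.
Qed.

(** * Soundness *)

Lemma connect_closed (T : finType) (e : rel T) (P : T -> Prop) x y :
  (forall x y, e x y -> P x -> P y) -> connect e x y -> P x -> P y.
Proof.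
move=> H /connectP[p + ->]; elim: p x => //= z p IH x /andP[exz /IH{}IH] /(H _ _ exz).
exact: IH.
Qed.

(** * Attaching leaves to out-trees *)

Section OutTrees.
Variables (n : nat) (a : rel 'I_n).
Implicit Types (S : {set 'I_n}) (A : {set 'I_n * 'I_n}).

Lemma leaves_le_ell S A : outtreeb a S A -> #|leaves S A| <= ell a.
Proof.
move=> H; apply: leq_trans
  (@leq_bigmax _ (fun S => \max_(A | outtreeb a S A) #|leaves S A|) S).
exact: (@leq_bigmax_cond _ (outtreeb a S) (fun A => #|leaves S A|) A H).
Qed.

Lemma ell_witness k : 0 < k -> k <= ell a ->
  exists S A, outtreeb a S A /\ k <= #|leaves S A|.
Proof.
move=> k0 kl.
have [/existsP[S /existsP[A /andP[H1 H2]]]|H] := boolP [exists S : {set 'I_n},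
  [exists A : {set 'I_n * 'I_n}, outtreeb a S A && (k <= #|leaves S A|)]].
  by exists S, A.
suff : ell a <= k.-1 by lia.
apply/bigmax_leqP => S _; apply/bigmax_leqP => A HA.
move: H; rewrite negb_exists => /forallP/(_ S).
rewrite negb_exists => /forallP/(_ A); rewrite HA /=; lia.
Qed.

Lemma outtree1 r : outtreeb a [set r] set0 /\ leaves [set r] set0 = [set r].
Proof.
have Hin v : indeg set0 v = 0 :> nat.
  by apply/eqP; rewrite cards_eq0 -subset0; apply/subsetP => x; rewrite !inE.
have Hout v : outdeg set0 v = 0 :> nat.
  by apply/eqP; rewrite cards_eq0 -subset0; apply/subsetP => x; rewrite !inE.
split; last by apply/setP => v; rewrite !inE Hout eqxx andbT.
apply/and4P; split.
- by apply/forallP => e; rewrite inE.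
- apply/and3P; split.
  + by apply/set0Pn; exists r; rewrite inE.
  + by apply/forall_inP => x /set1P->; apply/forall_inP => y /set1P->; apply: connect0.
  + by apply/forallP => e; rewrite inE.
- rewrite (_ : [set v in _ | _] = [set r]) ?cards1 //.
  by apply/setP => v; rewrite !inE Hin eqxx andbT.
- by apply/forall_inP => v _; rewrite Hin.
Qed.

Lemma und_sym A : symmetric (und A).
Proof. by move=> x y; rewrite /und orbC. Qed.

Lemma outtree_pendant S A u v : outtreeb a S A -> u \in S -> v \notin S -> a u v ->
  outtreeb a (v |: S) ((u, v) |: A) /\
  v |: (leaves S A :\ u) \subset leaves (v |: S) ((u, v) |: A).
Proof.
move=> /and4P[/forall_inP Hsub /and3P[_ /forall_inP Hcon /forall_inP Hbr] Hroot
  /forall_inP Hdeg] uS vS auv.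
have AS x y : (x, y) \in A -> x \in S /\ y \in S by move=> /Hsub /and3P[].
have uv : u != v by apply: contraNneq vS => <-.
have inl x : (x, v) \in A = false.
  by apply/negP => /AS[_]; rewrite (negbTE vS).
have inr x : (v, x) \in A = false.
  by apply/negP => /AS[+ _]; rewrite (negbTE vS).
have indeg_v : indeg ((u, v) |: A) v = 1.
  rewrite /indeg (_ : [set _ | _] = [set u]) ?cards1 //.
  by apply/setP => x; rewrite !inE inl orbF xpair_eqE eqxx andbT.
have indeg_w w : w != v -> indeg ((u, v) |: A) w = indeg A w.
  move=> wv; congr #|pred_of_set _|; apply/setP => x.
  by rewrite !inE xpair_eqE (negbTE wv) andbF.
have outdeg_v : outdeg ((u, v) |: A) v = 0.
  apply/eqP; rewrite cards_eq0 -subset0; apply/subsetP => x.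
  by rewrite !inE xpair_eqE eq_sym (negbTE uv) inr.
have outdeg_w w : w != u -> outdeg ((u, v) |: A) w = outdeg A w.
  move=> wu; congr #|pred_of_set _|; apply/setP => x.
  by rewrite !inE xpair_eqE (negbTE wu).
have memS w : w \in S -> w != v by move=> wS; apply: contraNneq vS => <-.
split; last first.
  apply/subsetP => w; rewrite !inE => /orP[/eqP->|/and3P[wu wS w0]].
    by rewrite eqxx outdeg_v.
  by rewrite wS orbT outdeg_w.
apply/and4P; split.
- apply/forall_inP => -[x y]; rewrite !inE =>
    /orP[/eqP[-> ->]|/Hsub/and3P[-> /= -> ->]] /=.
    by rewrite auv uS eqxx orbT.
  by rewrite !orbT.
- apply/and3P; split.
  + by apply/set0Pn; exists v; rewrite !inE eqxx.
  + have Hu x : x \in v |: S -> connect (und ((u, v) |: A)) u x.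
      rewrite !inE => /orP[/eqP->|xS].
        by apply: connect1; rewrite /und !inE eqxx.
      have := forall_inP (Hcon u uS) x xS; apply: connect_sub => y z Hyz.
      by apply: connect1; move: Hyz; rewrite /und !inE => /orP[]->; rewrite !orbT.
    apply/forall_inP => x Hx; apply/forall_inP => y Hy.
    apply: connect_trans (Hu y Hy).
    by rewrite (sym_connect_sym (@und_sym _)) Hu.
  + apply/forall_inP => e; have [-> _|euv] := eqVneq e (u, v).
      (* Without the arc [(u, v)] no edge touches [v], so a walk from [u] never arrives there. *)
      apply/negP => /(@connect_closed _ _ (fun x => x != v))H.
      suff : v != v by rewrite eqxx.
      apply: H uv => x y; rewrite /und !inE !xpair_eqE => /orP[] /andP[/negbTE->] /=
        /AS[].
        by move=> _ /memS.
      by move=> /memS.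
    rewrite in_setU1 (negbTE euv) /= => eA; apply: contra (Hbr e eA) => H.
    (* Folding [v] onto [u] turns a walk that avoids [e] in the larger tree into one that avoids [e]
       in [A]. *)
    pose h x := if x == v then u else x.
    have hS x : x \in S -> h x = x by move=> /memS/negbTE; rewrite /h => ->.
    have [e1 e2] : e.1 \in S /\ e.2 \in S by apply: AS; case: (e) eA.
    rewrite -(hS e.1) // -(hS e.2) //.
    apply: (@connect_closed _ _ (fun x => connect (und (A :\ e)) (h e.1) (h x)) _ _ _
      H) => //.
    move=> x y Hxy Hx; apply: connect_trans Hx _.
    have huv : h u = u /\ h v = u by rewrite hS // /h eqxx.
    move: Hxy; rewrite /und !inE => /orP[] /andP[exy] /orP[/eqP[-> ->]|xyA];
      rewrite ?huv.1 ?huv.2 //; have [xS yS] := AS _ _ xyA; rewrite !hS //;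
      by apply: connect1; rewrite /und !inE exy xyA ?orbT.
- rewrite (_ : [set w in _ | _] = [set w in S | indeg A w == 0]) //.
  apply/setP => w; rewrite !inE; have [->|wv] /= := eqVneq w v.
    by rewrite indeg_v (negbTE vS).
  by rewrite indeg_w.
- apply/forall_inP => w; rewrite !inE => /orP[/eqP->|wS]; first by rewrite indeg_v.
  by rewrite indeg_w ?memS // Hdeg.
Qed.

End OutTrees.

(** * Invariants of the search *)

Section Invariants.
Variables (n : nat) (a : rel 'I_n) (adj : nat -> nat -> bool).
Hypothesis adjE : forall u v : 'I_n, adj u v = a u v.

Lemma blueP m : let z := blue n m in
  if z == 0 then forall v : 'I_n, m v != 1
  else exists2 v : 'I_n, z = v.+1 & m v = 1.
Proof.
rewrite /blue /=; set f := (fun z v => _).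
suff H j : j <= n -> let z := foldl f 0 (iota 0 j) in
    if z == 0 then forall v : 'I_n, v < j -> m v != 1
    else exists2 v : 'I_n, z = v.+1 & m v = 1.
  have /= := H n (leqnn n); case: eqP => // _ H1 v; exact: H1.
elim: j => [//|j IH] jn; rewrite foldl_iotaS /=.
have /= := IH (ltnW jn); move: (foldl _ _ _) => z.
rewrite /f; case: (eqVneq (m j) 1) => [mj|mj] H.
  by rewrite /=; exists (Ordinal jn).
case: eqP H => // _ H v; rewrite ltnS leq_eqVlt => /orP[/eqP->|/H] //.
Qed.

(** Mark 2 does not tell decided leaves from inner vertices, so the leaves being counted are kept in
    an existential set [F]. *)
Definition tree_inv (s : conf) : Prop :=
  exists S A (F : {set 'I_n}),
    [/\ outtreeb a S A, forall v : 'I_n, (v \in S) = (mk s v != 0),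
    F \subset leaves S A, forall v : 'I_n, mk s v = 1 -> v \in F & fr s <= #|F|].

Definition forced_inv (s : conf) : Prop :=
  fw s = 0 \/ exists2 v : 'I_n, fw s = v.+1 & mk s v = 1.

Lemma start_inv (r : 'I_n) : tree_inv (start r) /\ forced_inv (start r).
Proof.
split; last by left.
have [H1 H2] := outtree1 a r; exists [set r], set0, [set r]; split=> //.
- by move=> v; rewrite inE /= eqb0 negbK.
- by rewrite H2.
- by move=> v /=; rewrite inE -val_eqE /=; case: (_ == _).
- by rewrite cards1.
Qed.

(** The vertex under expansion may acquire children, hence it is kept out of [F]. *)
Definition grow_inv (u : 'I_n) (s : conf) : Prop :=
  exists S A (F : {set 'I_n}), [/\ outtreeb a S A /\ F \subset leaves S A,
    forall v : 'I_n, (v \in S) = (mk s v != 0),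
    mk s u = 2 /\ u \notin F, forall v : 'I_n, mk s v = 1 -> v \in F & fr s <= #|F|].

Lemma grow_invS (u v : 'I_n) s :
  grow_inv u s /\ forced_inv s -> grow_inv u (grow adj u s v) /\ forced_inv
    (grow adj u s v).
Proof.
move=> [[S [A [F [[HT HF] HS [mu uF] Hb Hc]]]] Hfw].
rewrite /grow; case: ifP => [/andP[/eqP mv]|_]; last first.
  by split=> //; exists S, A, F.
rewrite adjE => auv.
have uS : u \in S by rewrite HS mu.
have vS : v \notin S by rewrite HS mv.
have uv : (u == v :> nat) = false by apply/eqP => E; move: mu; rewrite E mv.
have [HT' HL'] := outtree_pendant HT uS vS auv.
split; last first.
  rewrite /forced_inv /=; case: (cn s == 0); last by left.
  by right; exists v => //; rewrite /upd eqxx.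
exists (v |: S), ((u, v) |: A), (v |: F); split=> /=.
- split=> //; apply: subset_trans HL'; apply: setUS.
  by rewrite subsetD1 HF.
- move=> w; rewrite !inE HS /upd -val_eqE /=; by case: eqP.
- rewrite /upd uv; split=> //; rewrite !inE negb_or uF andbT.
  by rewrite -val_eqE /= uv.
- by move=> w; rewrite /upd !inE -val_eqE /=; case: eqP => //= _; apply: Hb.
- have vF : v \notin F.
    by apply: contra vS => /(subsetP HF); rewrite inE => /andP[].
  by rewrite cardsU1 vF add1n ltnS.
Qed.

Lemma expand_inv (u : 'I_n) s : tree_inv s -> mk s u = 1 ->
  tree_inv (expand n adj u s) /\ forced_inv (expand n adj u s).
Proof.
move=> [S [A [F [HT HS HF Hb Hc]]]] mu.
set s0 := Conf (upd (mk s) u 2) (fr s - 1) 0 0.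
have H0 : grow_inv u s0 /\ forced_inv s0.
  { split; last by left.
  exists S, A, (F :\ u); split=> //=.
  - by split=> //; apply: subset_trans HF; apply: subD1set.
  - by move=> w; rewrite /upd HS; case: (eqVneq (w : nat) u) => [->|//]; rewrite mu.
  - by rewrite /upd eqxx !inE eqxx.
  - move=> v; rewrite /upd !inE -val_eqE /=; case: eqP => //= _; exact: Hb.
  - by move: Hc; rewrite (cardsD1 u F) (Hb u mu) add1n leq_subLR add1n. }
suff H j : j <= n -> grow_inv u (foldl (grow adj u) s0 (iota 0 j)) /\
                      forced_inv (foldl (grow adj u) s0 (iota 0 j)).
  have [[S' [A' [F' [[H1 H2] H3 _ H4 H5]]]] H6] := H n (leqnn n).
  by split=> //; exists S', A', F'.
elim: j => // j IH jn; rewrite foldl_iotaS.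
exact: (@grow_invS u (Ordinal jn)) (IH (ltnW jn)).
Qed.

Lemma step1_inv T p :
  tree_inv p.1 /\ forced_inv p.1 ->
  tree_inv (step1 n adj T p).1 /\ forced_inv (step1 n adj T p).1.
Proof.
case: p => s h /= [Ht Hf]; rewrite /step1 /=.
case: Hf => [f0|[v fv mv]]; last first.
  by rewrite fv /= /advance fv /=; apply: expand_inv.
rewrite f0 eqxx /= /advance f0 eqxx; have /= := blueP (mk s).
  case: eqP => [_ _|_ [v -> mv]]; first by split=> //; left.
  rewrite /=; case: ifP => _; first exact: expand_inv.
  split; last by left.
  case: Ht => S [A [F [HT HS HF Hb Hc]]]; exists S, A, F; split=> //=.
  - by move=> w; rewrite /upd HS; case: (eqVneq (w : nat) v) => [->|//]; rewrite mv.
  - by move=> w; rewrite /upd; case: eqP => // _; apply: Hb.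
Qed.

Lemma accepts_sound k T (r : 'I_n) g : accepts n adj k T r g -> k <= ell a.
Proof.
move=> /hasP[i _ /leq_trans]; apply.
have : tree_inv (iter i (step1 n adj T) (start r, g)).1 /\
       forced_inv (iter i (step1 n adj T) (start r, g)).1.
  by elim: i => [|i IH]; [exact: start_inv | exact: step1_inv].
move=> [[S [A [F [HT _ HF _ Hc]]]] _].
by apply: leq_trans Hc _; apply: leq_trans (leaves_le_ell HT); apply: subset_leq_card.
Qed.

End Invariants.

(** * Completeness *)

Section InnerSets.
Variables (n : nat) (a : rel 'I_n) (r : 'I_n) (k : nat).
Implicit Types (I J R X : {set 'I_n}).

Definition touched I : {set 'I_n} := r |: [set v | [exists u in I, a u v]].
Definition front I : {set 'I_n} := touched I :\: I.
Definition fresh I (u : 'I_n) : {set 'I_n} := [set v | a u v] :\: (I :|: touched I).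

(* [I] is empty, or contains [r] and each of its vertices is reachable from [r]
   inside [I]. *)
Definition accessible I : bool :=
  [forall X : {set 'I_n}, (X \proper I) ==> [exists y in I :\: X, y \in touched X]].

(** The promise of a branch: a solution exists that keeps all of [I] inner and never makes a vertex
    of [R] inner. *)
Definition good I R : bool :=
  [exists J : {set 'I_n}, [&& I \subset J, accessible J, [disjoint J & R]
                            & k <= #|front J|]].

Lemma touchedP I v : reflect (v = r \/ exists2 u, u \in I & a u v) (v \in touched I).
Proof.
rewrite !inE; apply: (iffP orP) => [[/eqP|/exists_inP[u]]|[->|[u uI auv]]].
- by left.
- by right; exists u.
- by left.
- by right; apply/exists_inP; exists u.
Qed.

Lemma touched_mono I J : I \subset J -> touched I \subset touched J.
Proof.
move=> IJ; apply/subsetP => v /touchedP[->|[u /(subsetP IJ) uJ auv]]; apply/touchedP.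
  by left.
by right; exists u.
Qed.

Lemma touchedU1 I u : touched (u |: I) = touched I :|: [set v | a u v].
Proof.
apply/setP => v; rewrite in_setU [X in _ || X]inE; apply/touchedP/orP.
  case=> [->|[w]]; first by left; apply/touchedP; left.
  by rewrite in_setU1 => /orP[/eqP->|wI] awv;
    [right | left; apply/touchedP; right; exists w].
case=> [/touchedP[->|[w wI awv]]|auv]; first by left.
  by right; exists w => //; rewrite !inE wI orbT.
by right; exists u; rewrite ?inE ?eqxx.
Qed.

Lemma accessibleP I : reflect
  (forall X, X \proper I -> exists2 y, y \in I :\: X & y \in touched X)
  (accessible I).
Proof.
apply: (iffP forallP) => [H X XI|H X].
  by have /implyP/(_ XI)/exists_inP := H X.
by apply/implyP => /H ?; apply/exists_inP.
Qed.

Lemma accessibleU1 I u : accessible I -> u \in touched I -> accessible (u |: I).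
Proof.
move=> /accessibleP HI uI; apply/accessibleP => X XI.
have [IX|IX] := boolP (I \subset X).
  have uX : u \notin X.
    apply/negP => uX; move: XI; rewrite properE => /andP[_ /negP[]].
    by rewrite subUset sub1set uX.
  by exists u; [rewrite !inE uX eqxx | apply: (subsetP (touched_mono IX))].
have /HI[y] : X :&: I \proper I.
  rewrite properE subsetIr; apply: contra IX => H.
  by apply: subset_trans H _; apply: subsetIl.
move=> + yt; rewrite in_setD in_setI => /andP[yX yI]; exists y.
  by move: yX; rewrite yI andbT in_setD in_setU1 => ->; rewrite yI orbT.
by apply: (subsetP (touched_mono _)) yt; apply: subsetIl.
Qed.

(* [J :\ u] works: its frontier gains [u] and loses at most the fresh vertex. *)
Lemma good_red I R J u :
  accessible I -> u \in front I -> u |: I \subset J -> accessible J ->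
  [disjoint J & R] -> k <= #|front J| ->
  #|fresh I u| <= 1 -> [disjoint fresh I u & J] -> good I (u |: R).
Proof.
move=> HI uf uIJ HJ JR kJ f1 fJ.
have [uI ut] : u \notin I /\ u \in touched I by move: uf; rewrite in_setD => /andP[].
have [uJ IJ] : u \in J /\ I \subset J by move: uIJ; rewrite subUset sub1set => /andP[].
have IJu : I \subset J :\ u by rewrite subsetD1 IJ.
have old v : a u v -> v \notin fresh I u -> v \notin I -> v \in touched I.
  by move=> auv; rewrite !in_setD inE auv andbT negbK in_setU => /orP[->|].
have notfresh v : v \in J -> v \notin fresh I u.
  by move=> vJ; apply/negP => vf; have := disjointFr fJ vf; rewrite vJ.
apply/existsP; exists (J :\ u); apply/and4P; split=> //.
- apply/accessibleP => X XJ.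
  have [IX|IX] := boolP (I \subset X); last first.
    have /(accessibleP _ HI)[y] : X :&: I \proper I.
      rewrite properE subsetIr; apply: contra IX => H.
      by apply: subset_trans H _; apply: subsetIl.
    move=> + yt; rewrite in_setD in_setI => /andP[yX yI]; exists y.
      move: yX; rewrite yI andbT => yX; rewrite in_setD in_setD1 yX (subsetP IJ) // andbT.
      by apply: contraNneq uI => <-.
    by apply: (subsetP (touched_mono _)) yt; apply: subsetIl.
  have [XJs uX] : X \subset J /\ u \notin X.
    by apply/andP; rewrite -subsetD1; apply: proper_sub.
  (* Accessibility of [J] is applied with [u] added to [X]. If the vertex found depends on an arc
     from [u], it lies in [J] and so is not fresh, hence [I] already touches it, and so does [X]. *)
  have /(accessibleP _ HJ)[y] : u |: X \proper J.
    rewrite properE subUset sub1set uJ XJs /=.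
    apply: contraTN XJ => H; rewrite properE negb_and negbK; apply/orP; right.
    by rewrite subDset.
  move=> + yt; rewrite in_setD in_setU1 negb_or => /andP[/andP[yu yX] yJ].
  exists y; first by rewrite in_setD in_setD1 yX yu yJ.
  move: yt; rewrite touchedU1 in_setU [X in _ || X]inE => /orP[//|auy].
  apply: (subsetP (touched_mono IX)); apply: old => //; first exact: notfresh.
  by apply: contra yX; apply: subsetP.
- rewrite -setI_eq0; apply/eqP/setP => x; rewrite !inE.
  case: (eqVneq x u) => //= _; case xJ: (x \in J) => //=.
  exact: disjointFr JR xJ.
- apply: leq_trans kJ _.
  (* A frontier vertex of [J] that owes its place to [u] alone must be fresh; every other one
     survives, and [u] itself joins. *)
  have sub : u |: (front J :\: fresh I u) \subset front (J :\ u).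
    apply/subsetP => v; rewrite in_setU1 => /orP[/eqP->|].
      by rewrite in_setD in_setD1 eqxx (subsetP (touched_mono IJu)).
    rewrite in_setD => /andP[vf]; rewrite in_setD => /andP[vJ vt].
    rewrite in_setD in_setD1 (negbTE vJ) andbF /=.
    move: vt; rewrite -{1}(setD1K uJ) touchedU1 in_setU [X in _ || X]inE => /orP[//|auv].
    apply: (subsetP (touched_mono IJu)); apply: old => //.
    by apply: contra vJ; apply: subsetP.
  apply: leq_trans (subset_leq_card sub); rewrite cardsU1 !inE uJ andbF /= add1n.
  rewrite -(cardsID (fresh I u) (front J)) -addn1 addnC leq_add2l.
  by apply: leq_trans f1; apply: subset_leq_card; apply: subsetIr.
Qed.

Lemma front_U1 I u : u \in front I -> front (u |: I) = (front I :\ u) :|: fresh I u.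
Proof.
rewrite in_setD => /andP[uI ut]; apply/setP => v.
have E1 : (v \in touched (u |: I)) = (v \in touched I) || a u v.
  by rewrite touchedU1 in_setU [X in _ || X]inE.
have E2 : (v \in fresh I u) = ~~ ((v \in I) || (v \in touched I)) && a u v.
  by rewrite in_setD in_setU [X in _ && X]inE.
rewrite in_setU in_setD1 E2 !in_setD in_setU1 E1.
case: (eqVneq v u) => [->|_] /=; first by rewrite ut orbT.
by case: (v \in I); case: (v \in touched I).
Qed.

(** The change of the measure when [u] becomes inner: a strict gain as soon as two vertices are
    fresh. *)
Lemma card_front_U1 I R u : u \in front I -> u \notin R -> R \subset front I ->
  #|front (u |: I) :\: R| = #|front I :\: R| - 1 + #|fresh I u|.
Proof.
move=> uf uR Rf.
have dis : [disjoint fresh I u & touched I].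
  rewrite -setI_eq0 -subset0; apply/subsetP => v.
  by rewrite in_setI in_setD in_setU negb_or => /andP[/andP[/andP[_ /negbTE->]]].
have ft : front I \subset touched I by apply: subsetDl.
rewrite front_U1 // setDUl.
have -> : fresh I u :\: R = fresh I u.
  apply/setDidPl; apply: disjointWr dis; exact: subset_trans ft.
rewrite cardsU; have -> : (front I :\ u :\: R) :&: fresh I u = set0.
  apply/eqP; rewrite setI_eq0 disjoint_sym; apply: disjointWr dis.
  by apply: subset_trans ft; rewrite setDDl; apply: subsetDl.
rewrite cards0 subn0; congr (_ + _).
by rewrite setDDl setUC -setDDl (cardsD1 u (front I :\: R)) in_setD uR uf add1n subn1.
Qed.

End InnerSets.

(** * Guesses that lead to success *)

Section Completeness.
Variables (n : nat) (a : rel 'I_n) (adj : nat -> nat -> bool).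
Hypothesis adjE : forall u v : 'I_n, adj u v = a u v.
Variables (r : 'I_n) (k : nat).
Implicit Types (I J R : {set 'I_n}) (s : conf).
Notation front := (front a r).
Notation fresh := (fresh a r).
Notation touched := (touched a r).
Notation accessible := (accessible a r).
Notation good := (good a r k).

(** Both [I] and [R] carry mark 2, so they are ghost data that the configuration does not
    determine. *)
Record rel_conf (s : conf) (I R : {set 'I_n}) : Prop := RelConf {
  rel_acc : accessible I;
  rel_sub : R \subset front I;
  rel_mk : forall v : 'I_n, mk s v =
    if v \in I :|: R then 2 else if v \in front I then 1 else 0;
  rel_fr : fr s = #|front I| }.

Lemma expand_fold (u : 'I_n) s j : j <= n -> cn s = 0 -> fw s = 0 -> mk s u != 0 ->
  let F := [set v : 'I_n | [&& v < j, mk s v == 0 & a u v]] in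
  let s' := foldl (grow adj u) s (iota 0 j) in
  [/\ forall v : 'I_n, mk s' v = if v \in F then 1 else mk s v,
      fr s' = fr s + #|F|, cn s' = #|F|
    & if #|F| == 1 then exists2 v, v \in F & fw s' = (v : 'I_n).+1 else fw s' = 0].
Proof.
move=> + c0 f0 mu; elim: j => [_|j IH jn].
  have -> : [set v : 'I_n | [&& v < 0, mk s v == 0 & a u v]] = set0.
    by apply/setP => v; rewrite !inE.
  by rewrite /= cards0 addn0; split=> // v; rewrite inE.
rewrite foldl_iotaS; have /= := IH (ltnW jn).
set F := [set v : 'I_n | [&& v < j, mk s v == 0 & a u v]].
set F' := [set v : 'I_n | [&& v < j.+1, mk s v == 0 & a u v]].
move: (foldl _ _ _) => s1 [H1 H2 H3 H4]; pose w := Ordinal jn.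
have wF : w \notin F by rewrite inE /= ltnn.
have mw : mk s1 j = mk s j by have := H1 w; rewrite (negbTE wF).
have FF' v : (v \in F') = (v \in F) || [&& v == w, mk s j == 0 & a u w].
  rewrite !inE ltnS leq_eqVlt -val_eqE /=.
  case: (eqVneq (v : nat) j) => [E|_] /=; last by rewrite orbF.
  have -> : v = w by apply: val_inj.
  by rewrite /= ltnn.
rewrite /grow mw -[adj u j]/(adj u w) adjE.
case: ifP => E; last first.
  have -> : F' = F by apply/setP => v; rewrite FF' E andbF orbF.
  by split.
have EF : F' = w |: F by apply/setP => v; rewrite FF' E andbT in_setU1 orbC.
have cF : #|F'| = #|F|.+1 by rewrite EF cardsU1 wF.
rewrite /= cF H2 H3 addnS; split=> //.
- move=> v; rewrite EF in_setU1 /upd -val_eqE /= H1; by case: eqP.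
- rewrite eqSS; case: eqP => // F0; exists w => //.
  by rewrite EF in_setU1 eqxx.
Qed.

Lemma expand_rel s I R (u : 'I_n) : rel_conf s I R -> u \in front I -> u \notin R ->
  rel_conf (expand n adj u s) (u |: I) R /\
  (if #|fresh I u| == 1 then exists2 v, v \in fresh I u & fw (expand n adj u s) =
    (v : 'I_n).+1
   else fw (expand n adj u s) = 0).
Proof.
move=> [Hacc Hsub Hmk Hfr] uf uR.
have [uI ut] : u \notin I /\ u \in touched I by move: uf; rewrite in_setD => /andP[].
set s0 := Conf (upd (mk s) u 2) (fr s - 1) 0 0.
have := @expand_fold u s0 n (leqnn n) erefl erefl; rewrite /= {1}/upd eqxx => /(_ isT).
(* The marked vertices are those of [I] and its frontier, as [R] lies in the frontier; an unmarked
   out-neighbour is therefore a fresh one. *)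
have -> : [set v : 'I_n | [&& v < n, upd (mk s) u 2 v == 0 & a u v]] = fresh I u.
  apply/setP => v; rewrite in_setD in_setU [X in _ = _ && X]inE inE ltn_ord /= /upd.
  case: (eqVneq (v : nat) u) => [/val_inj->|vu] /=; first by rewrite ut orbT.
  rewrite Hmk in_setU in_setD negb_or; case vI: (v \in I) => //=.
  have [vR|vR] /= := boolP (v \in R).
    by move: (subsetP Hsub _ vR); rewrite in_setD => /andP[_ ->].
  by case: (v \in touched I).
rewrite -/(expand n adj u s); move=> [H1 H2 H3 H4]; split; last by case: ifP H4.
split.
- exact: accessibleU1.
- rewrite front_U1 //; apply/subsetP => v vR; rewrite in_setU in_setD1 (subsetP Hsub)
    // andbT.
  by apply/orP; left; apply: contraNneq uR => <-.
- move=> v; rewrite H1 front_U1 // in_setU in_setU1 [in RHS]in_setU in_setD1 /upd.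
  have [vf|vf] := boolP (v \in fresh I u).
    have : v \notin I :|: touched I by move: vf; rewrite in_setD => /andP[].
    rewrite in_setU negb_or => /andP[/negbTE vI vt].
    have vu : (v == u) = false by apply: contraNF vt => /eqP->.
    have vR : (v \in R) = false.
      by apply: contraNF vt => /(subsetP Hsub); rewrite in_setD => /andP[].
    by rewrite vu vI vR /= orbT.
  rewrite orbF -val_eqE /=; case: eqP => //= vu; by rewrite Hmk in_setU.
- rewrite H2 /= Hfr; have := @card_front_U1 _ a r I set0 u uf; rewrite !setD0 inE => ->
    //.
  exact: sub0set.
Qed.

(** The remaining bits sit at the top of an [L]-bit word with zeros below, so doubling overflows
    exactly when the leading bit is 1, and the reduction keeps the rest aligned. *)
Lemma bit_split L m g' (b : bool) : m < L -> g' < 2 ^ m ->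
  let g := b * 2 ^ m + g' in
  [/\ g < 2 ^ m.+1,
      (2 ^ L <= g * 2 ^ (L - m.+1) + g * 2 ^ (L - m.+1)) = b
    & shift (2 ^ L) (g * 2 ^ (L - m.+1)) = g' * 2 ^ (L - m)].
Proof.
move=> mL Hg' g.
have E2 : g * 2 ^ (L - m.+1) + g * 2 ^ (L - m.+1) = b * 2 ^ L + g' * 2 ^ (L - m).
  rewrite addnn -mul2n mulnCA -expnS -subSn // subSS /g mulnDl -mulnA -expnD subnKC //.
  exact: ltnW.
have lt : g' * 2 ^ (L - m) < 2 ^ L.
  by rewrite -{2}(subnKC (ltnW mL)) expnD ltn_pmul2r // expn_gt0.
rewrite /shift E2; split.
- by rewrite expnS /g; case: (b); lia.
- by case: (b); rewrite ?mul1n ?leq_addr ?mul0n ?add0n // leqNgt lt.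
- by case: (b); rewrite ?mul1n ?mul0n ?add0n ?leq_addr ?addKn // leqNgt lt.
Qed.

(** Here [m] is the number of unread bits: the measure plus what they can still add reaches
    [2 * k]. *)
Definition free_state s I R m : Prop :=
  [/\ fw s = 0, good I R & 2 * k <= 2 * #|R| + #|front I :\: R| + m].

(** The extra 1 is the debt of a running chain: its bit has been read, but the gain is still to
    come. That [v] cannot stay a leaf is recorded because it is what makes the next expansion
    productive. *)
Definition forced_state s I R m : Prop :=
  exists v : 'I_n, [/\ fw s = v.+1, v \in front I :\: R, good (v |: I) R,
    ~~ good I (v |: R) & 2 * k <= 2 * #|R| + #|front I :\: R| + m + 1].

Lemma goodP I R : reflect
  (exists J, [/\ I \subset J, accessible J, [disjoint J & R] & k <= #|front J|])
    (good I R).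
Proof. by apply: (iffP existsP) => -[J /and4P H]; exists J; exact: H. Qed.

Lemma disjoint_setU1r J R (v : 'I_n) :
  [disjoint J & v |: R] = (v \notin J) && [disjoint J & R].
Proof.
rewrite -!setI_eq0 setIUr setU_eq0; congr (_ && _).
by rewrite setI_eq0 disjoint_sym disjoints1.
Qed.

(** Two fresh vertices pay the debt. Otherwise [good_red] applies to any solution that avoids the
    fresh vertices and would allow [u] to be a leaf; so there is exactly one, it belongs to the
    solution, and it inherits the debt. *)
Lemma expand_state s I R (u : 'I_n) m : rel_conf s I R -> u \in front I :\: R ->
  good (u |: I) R -> ~~ good I (u |: R) ->
  2 * k <= 2 * #|R| + #|front I :\: R| + m + 1 ->
  let s' := expand n adj u s in
  rel_conf s' (u |: I) R /\
  (free_state s' (u |: I) R m \/ forced_state s' (u |: I) R m).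
Proof.
move=> Hrel ufR Hg Hng Hm s'.
have [uR uf] : u \notin R /\ u \in front I by move: ufR; rewrite in_setD => /andP[].
have [Hrel' Hfw] := expand_rel Hrel uf uR; split=> //.
have Hcard := card_front_U1 uf uR (rel_sub Hrel).
have c0 : 0 < #|front I :\: R| by apply/card_gt0P; exists u.
have Hacc := rel_acc Hrel.
have [f1|f1] := leqP #|fresh I u| 1; last first.
  left; split=> //; last by rewrite Hcard; lia.
  by move: Hfw; case: eqP => // E; rewrite E in f1.
have /goodP[J [IJ HJ JR kJ]] := Hg.
have [d|nd] := boolP [disjoint fresh I u & J].
  by case/negP: Hng; apply: (@good_red n a r k I R J u).
move: nd; rewrite -setI_eq0 => /set0Pn[v]; rewrite in_setI => /andP[vf vJ].
have E1 : #|fresh I u| = 1 by apply/eqP; rewrite eqn_leq f1; apply/card_gt0P; exists v.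
have Ef : fresh I u = [set v].
  have /cards1P[x Ex] : #|fresh I u| == 1 by rewrite E1.
  by move: vf; rewrite Ex in_set1 => /eqP->.
right; exists v; move: Hfw; rewrite E1 eqxx Ef => -[v' /set1P-> Efw].
have vt : v \notin I :|: touched I by move: vf; rewrite in_setD => /andP[].
have vR : v \notin R.
  apply: contra vt => /(subsetP (rel_sub Hrel)); rewrite in_setD => /andP[_ vt'].
  by apply/setUP; right.
split=> //.
- by rewrite in_setD vR front_U1 // Ef !inE eqxx orbT.
- apply/goodP; exists J; split=> //; by rewrite subUset sub1set vJ.
- apply/negP => /goodP[J' [IJ' HJ' JR' kJ']].
  move: JR'; rewrite disjoint_setU1r => /andP[vJ' JR'].
  case/negP: Hng; apply: (@good_red n a r k I R J' u) => //.
  by rewrite Ef disjoints1.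
- by rewrite Hcard E1 subnK.
Qed.

Lemma good_cases I R u : good I R -> good (u |: I) R || good I (u |: R).
Proof.
move=> /goodP[J [IJ HJ JR kJ]]; have [uJ|uJ] := boolP (u \in J).
  by apply/orP; left; apply/goodP; exists J; split=> //; rewrite subUset sub1set uJ.
by apply/orP; right; apply/goodP; exists J; split=> //; rewrite disjoint_setU1r uJ.
Qed.

(** As the frontier of [I] is too small, the promised [J] is strictly larger than [I]; accessibility
    supplies a frontier vertex in [J], which avoids [R]. *)
Lemma blue_exists s I R : rel_conf s I R -> good I R -> fr s < k ->
  exists2 u : 'I_n, blue n (mk s) = u.+1 & u \in front I :\: R.
Proof.
move=> [Hacc Hsub Hmk Hfr] /goodP[J [IJ HJ JR kJ]] fk.
have /= := blueP n (mk s); case: (eqVneq (blue n (mk s)) 0) => [_ Hno|_ [u Eu mu]];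
  last first.
  exists u => //; move: mu; rewrite [u \in _ :\: R]in_setD Hmk in_setU.
  by case: (u \in I) => //=; case: (u \in R) => //=; case: (u \in front I).
have IJne : I \proper J.
  rewrite properEneq IJ andbT; by apply: contraTneq fk => E; rewrite -leqNgt Hfr E.
have [y] := accessibleP _ _ _ HJ _ IJne; rewrite in_setD => /andP[yI yJ] yt.
have yf : y \in front I by rewrite in_setD yI.
have := Hno y; rewrite Hmk in_setU (negbTE yI) yf /=.
by rewrite (disjointFr JR yJ).
Qed.

(** Induction on the undecided vertices, whose number drops at every step, forced or not. The guess
    is built from its last bit backwards. *)
Lemma complete L s I R m d : rel_conf s I R -> #|~: (I :|: R)| < d ->
  free_state s I R m \/ forced_state s I R m -> m <= L ->
  exists2 g, g < 2 ^ m &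
    exists2 i, i < d & k <= fr (iter i (step1 n adj (2 ^ L)) (s, g * 2 ^ (L - m))).1.
Proof.
elim: d s I R m => // d IH s I R m Hrel Hd Hst mL.
have [kf|kf] := leqP k (fr s).
  by exists 0; [rewrite expn_gt0 | exists 0].
have grow_card u (I' R' : {set 'I_n}) : u \in front I :\: R -> I' :|: R' = u |:
  (I :|: R) ->
    #|~: (I' :|: R')| < d.
  move=> uf ->; apply: (@leq_trans #|~: (I :|: R)|); last by rewrite -ltnS.
  rewrite setUC setCU -setDE.
  rewrite [X in _ < X](cardsD1 u) inE in_setU negb_or.
  by move: uf; rewrite !in_setD => /andP[-> /andP[-> _]].
have [[f0 Hg Hm]|[v [fv vf Hg Hng Hm]]] := Hst; last first.
  have [Hrel' Hst'] := expand_state Hrel vf Hg Hng Hm.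
  have [g Hgm [i Hi Hk]] := IH _ _ _ _ Hrel' (grow_card v _ _ vf (esym (setUA _ _ _)))
    Hst' mL.
  exists g => //; exists i.+1 => //; rewrite iterSr.
  by rewrite {2}/step1 /= fv /= /advance fv.
have [u Eu uf] := blue_exists Hrel Hg kf.
have Hf := cardsID R (front I).
(* A bit is left: the measure is at most twice the frontier, which is below [2 * k]. *)
have mL1 : exists m', m = m'.+1.
  exists m.-1; rewrite prednK //.
  have := rel_fr Hrel; have : #|front I :&: R| = #|R|.
    by congr #|pred_of_set _|; apply/setIidPr; apply: rel_sub Hrel.
  lia.
have [m' Em] := mL1; rewrite Em in Hm mL *.
have Hadv (b : bool) g' : g' < 2 ^ m' ->
    let g := b * 2 ^ m' + g' in
    g < 2 ^ m'.+1 /\ step1 n adj (2 ^ L) (s, g * 2 ^ (L - m'.+1)) =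
      (if b then expand n adj u s else Conf (upd (mk s) u 2) (fr s) (fw s) (cn s),
       g' * 2 ^ (L - m')).
  move=> Hg'; have [H1 H2 H3] := bit_split b mL Hg'; split=> //.
  by rewrite /step1 /= f0 /= H2 H3 /advance f0 /= Eu.
(* The leaf is preferred whenever possible, so an expansion starts with the knowledge that [u]
   cannot be one. *)
have [Hr|Hr] := boolP (good I (u |: R)).
  have uR : u \notin R by move: uf; rewrite in_setD => /andP[].
  have uF : u \in front I by move: uf; rewrite in_setD => /andP[].
  set s' := Conf (upd (mk s) u 2) (fr s) (fw s) (cn s).
  have Hrel' : rel_conf s' I (u |: R).
    case: Hrel => Hacc Hsub Hmk Hfr; split=> //; first by rewrite subUset sub1set uF.
    move=> v; rewrite /= /upd Hmk !in_setU in_set1 -val_eqE /=.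
    by case: eqP => //= _; rewrite orbT.
  have Hfree : free_state s' I (u |: R) m'.
    split=> //; rewrite cardsU1 uR add1n.
    have -> : front I :\: (u |: R) = front I :\: R :\ u by rewrite setDDl setUC.
    by move: Hm; rewrite (cardsD1 u (front I :\: R)) uf add1n mulnS !addnS !addSn.
  have [g' Hg' [i Hi Hk]] := IH s' I (u |: R) m' Hrel' (grow_card u _ _ uf (setUCA _ _ _))
    (or_introl Hfree) (ltnW mL).
  have [H1 H2] := Hadv false g' Hg'.
  by exists (false * 2 ^ m' + g') => //; exists i.+1 => //; rewrite iterSr H2.
have Hg' : good (u |: I) R by have := good_cases u Hg; rewrite (negbTE Hr) orbF.
have [|Hrel' Hst'] := expand_state (m := m') Hrel uf Hg' Hr; first by lia.
have [|g' Hgm [i Hi Hk]] := IH _ _ _ _ Hrel' (grow_card u _ _ uf (esym (setUA _ _ _)))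
  Hst'.
  exact: ltnW.
have [H1 H2] := Hadv true g' Hgm.
by exists (true * 2 ^ m' + g') => //; exists i.+1 => //; rewrite iterSr H2.
Qed.
End Completeness.

(** * From out-trees to the decision problem *)

Section Final.
Variables (n : nat) (a : rel 'I_n) (adj : nat -> nat -> bool).
Hypothesis adjE : forall u v : 'I_n, adj u v = a u v.

(** The witness is the set of non-leaves of the out-tree, whose frontier contains all its leaves. *)
Lemma outtree_good k S A : 1 < k -> outtreeb a S A -> k <= #|leaves S A| ->
  exists r, good a r k set0 set0.
Proof.
move=> k1 /and4P[/forall_inP Hsub /and3P[_ /forall_inP Hcon _] /cards1P[r Hr]
  /forall_inP Hdeg] kl.
have AS x y : (x, y) \in A -> [/\ a x y, x \in S & y \in S] by move=> /Hsub /and3P[].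
have parent y : y \in S -> y != r -> exists x, (x, y) \in A.
  move=> yS yr; have : indeg A y != 0.
    apply: contra yr => y0; have : y \in [set v in S | indeg A v == 0] by rewrite inE yS.
    by rewrite Hr inE.
  by rewrite -lt0n => /card_gt0P[x]; rewrite inE; exists x.
have [rS r0] : r \in S /\ indeg A r = 0.
  have : r \in [set v in S | indeg A v == 0] by rewrite Hr inE.
  by rewrite inE => /andP[? /eqP].
have norp x : (x, r) \in A = false.
  by apply/negP => xr; have := cards0_eq r0 => /setP/(_ x); rewrite !inE xr.
have uniq_parent x y z : (x, z) \in A -> (y, z) \in A -> x = y.
  move=> xz yz; have [_ _ zS] := AS _ _ xz; have := Hdeg z zS; case/orP => /eqP E.
    by have := cards0_eq E => /setP/(_ x); rewrite !inE xz.
  have /cards1P[w Ew] : #|[set u | (u, z) \in A]| == 1 by apply/eqP.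
  have : x \in [set w] by rewrite -Ew inE.
  have : y \in [set w] by rewrite -Ew inE.
  by rewrite !inE => /eqP-> /eqP->.
pose dA : rel 'I_n := fun x y => (x, y) \in A.
have reach x : x \in S -> connect dA r x.
  move=> xS; have Hrx := forall_inP (Hcon r rS) x xS.
  (* An undirected walk from the root is turned into a directed one: a forward arc is appended, and
     a backward arc must undo the last one because parents are unique. *)
  apply: (connect_closed (P := fun y => connect dA r y) _ Hrx); last exact: connect0.
  move=> y z /orP[yz|zy] ry; first by apply: connect_trans ry _; apply: connect1.
  have [p pp Ey] := connectP ry; move: pp Ey; case: (lastP p) => [|p' w].
    by move=> _ /= E; move: zy; rewrite E norp.
  rewrite rcons_path last_rcons => /andP[pp' lw] Ew; rewrite Ew in zy.
  by rewrite (uniq_parent _ _ _ zy lw); apply/connectP; exists p'.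
exists r; apply/existsP; pose J := S :\: leaves S A; exists J.
have arcJ x y : (x, y) \in A -> x \in J.
  move=> xy; have [_ xS _] := AS _ _ xy; rewrite in_setD xS andbT inE xS /=.
  by rewrite -lt0n; apply/card_gt0P; exists y; rewrite inE.
apply/and4P; split.
- exact: sub0set.
- apply/accessibleP => X XJ.
  have [XJ' nJX] := andP (XJ : (X \subset J) && ~~ (J \subset X)).
  apply/exists_inP; apply: contraNT nJX; rewrite negb_exists_in => /forall_inP HX.
  apply/subsetP => x xJ.
  have xS : x \in S by move: xJ; rewrite in_setD => /andP[].
  move: xJ.
  (* If [X] touches nothing more of [J], membership in [X] spreads from the root along the arcs,
     whose tails all lie in [J]. *)
  apply: (connect_closed (P := fun y => y \in J -> y \in X) _ (reach _ xS)).
    move=> y z yz Hy zJ; have yX := Hy (arcJ _ _ yz); apply: contraT => zX.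
    have /HX/negP[] : z \in J :\: X by rewrite in_setD zX.
    by apply/touchedP; right; exists y => //; case: (AS _ _ yz).
  move=> rJ; apply: contraT => rX; have /HX/negP[] : r \in J :\: X by rewrite in_setD rX.
  by apply/touchedP; left.
- by rewrite disjoint_sym -setI_eq0 set0I.
- apply: leq_trans kl _; apply: subset_leq_card; apply/subsetP => x xl.
  rewrite in_setD in_setD xl /=; apply/touchedP.
  have xS : x \in S by move: xl; rewrite inE => /andP[].
  have [->|/(parent _ xS)[y yx]] := eqVneq x r; first by left.
  by right; exists y; [exact: arcJ yx | case: (AS _ _ yx)].
Qed.

Lemma good_accepts k (r : 'I_n) : good a r k set0 set0 ->
  exists2 g, g < 4 ^ k & accepts n adj k (4 ^ k) r g.
Proof.
move=> Hg; have E4 : 4 ^ k = 2 ^ (2 * k) by rewrite expnM.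
have front0 : front a r set0 = [set r].
  apply/setP => v; rewrite in_setD inE /=; apply/touchedP/set1P => [[//|[u]]|->].
    by rewrite inE.
  by left.
have Hrel : rel_conf a r (start r) set0 set0.
  { split; rewrite ?front0 ?cards1 ?sub0set //.
  - apply/accessibleP => X; rewrite properE sub0set andbF //.
  - by move=> v; rewrite !inE -val_eqE /=; case: eqP. }
have Hcard : #|~: (set0 :|: set0 : {set 'I_n})| < n.+1 
  by rewrite ltnS; apply: leq_trans (max_card _) _; rewrite card_ord.
have Hfree : free_state a r k (start r) set0 set0 (2 * k) by split=> //; rewrite leq_addl.
have [g Hgm [i Hi Hk]] := complete adjE Hrel Hcard (or_introl Hfree) (leqnn (2 * k)).
exists g; rewrite E4 //; apply/hasP; exists i; first by rewrite mem_iota.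
by rewrite subnn muln1 in Hk.
Qed.

Lemma solveE k : 0 < k -> solve n adj k (4 ^ k) = (k <= ell a).
Proof.
move=> k0; apply/idP/idP => [/hasP[r]|kl].
  rewrite mem_iota /= => rn /hasP[g _].
  exact: (@accepts_sound n a adj adjE k (4 ^ k) (Ordinal rn) g).
suff [r [g Hg1 Hg2]] : exists r : 'I_n, exists2 g, g < 4 ^ k & accepts n adj k (4 ^ k)
  r g.
  apply/hasP; exists (r : nat); first by rewrite mem_iota /=.
  by apply/hasP; exists g; first by rewrite mem_iota.
have [S [A [HT HL]]] := ell_witness k0 kl.
have [k1|k1] := leqP k 1; last first.
  by have [r /good_accepts] := outtree_good k1 HT HL; exists r.
(* For [k = 1] the start configuration, with its frontier of size 1, is already accepted. *)
have /card_gt0P[r _] : 0 < #|leaves S A| by exact: leq_trans HL.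
exists r, 0; first by rewrite expn_gt0.
by apply/hasP; exists 0; rewrite ?mem_iota.
Qed.

End Final.

Definition adjn (n : nat) (a : rel 'I_n) (u v : nat) : bool :=
  if insub u is Some i then if insub v is Some j then a i j else false else false.

Lemma adjnE n (a : rel 'I_n) (u v : 'I_n) : adjn a u v = a u v.
Proof. by rewrite /adjn !valK. Qed.

Lemma nth_allpairs (T S U : Type) (f : S -> T -> U) s t x y z i j :
  i < size s -> j < size t ->
  nth z (allpairs f s t) (i * size t + j) = f (nth x s i) (nth y t j).
Proof.
elim: s i => // w s IH [|i] /= Hi Hj; rewrite nth_cat size_map.
  by rewrite mul0n add0n Hj (nth_map y).
by rewrite mulSn -addnA ltnNge leq_addr /= addKn IH.
Qed.

Lemma nth_encode n (a : rel 'I_n) k u v : u < n -> v < n ->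
  nth 0 (encode a k) (2 + u * n + v) = adjn a u v.
Proof.
move=> Hu Hv; rewrite /encode -addnA nth_cat /= addKn.
have -> : u * n + v = u * size (enum 'I_n) + v by rewrite size_enum_ord.
rewrite (nth_allpairs _ (Ordinal Hu) (Ordinal Hv)) ?size_enum_ord //.
by rewrite -adjnE !nth_enum_ord.
Qed.

(* There is a RAM program P and a constant c such that on every instance
   (D, k) with D a loopless digraph on n vertices and k >= 1, P halts
   within 2^(c * k * (log k + 1)) * (n+1)^c steps, outputting 1 in
   register 0 if l(D) >= k and 0 otherwise. *)
Theorem theorem1 :
  exists (P : program) (c : nat),
    forall (n : nat) (a : rel 'I_n) (k : nat),
      irreflexive a -> 0 < k ->
      exists m : nat -> nat,
        run P (2 ^ (c * k * (trunc_log 2 k).+1) * n.+1 ^ c) (init (encode a k))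
          = Some m
        /\ m 0 = nat_of_bool (k <= ell a).
Proof.
exists (comp 0 main_code), 14 => n a k irr k0.
have [m Hm E] := main_run (erefl : nth 0 (encode a k) 0 = n)
  (erefl : nth 0 (encode a k) 1 = k) (@nth_encode n a k)
  (main_time_le n k0 (ltn0Sn (trunc_log 2 k))).
by exists m; rewrite E (solveE (@adjnE n a)).
Qed.
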